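(* Let $n,d,c\in\mathbb{N}$ with $d\ge 50$ and $1\le c\le d$. For every hereditary family $\mathcal{F}\subseteq 2^{[n]}$ with $\delta(\mathcal{F})\ge 2^{d-1}-c+1$, we have $\sum_{x\in[n]}\omega_{\mathcal{F}}(x)\ge \mathfrak{B}_c\, n$.
   Context: A family $\mathcal{F}\subseteq 2^{[n]}$ is hereditary if $F'\subseteq F\in\mathcal{F}$ implies $F'\in\mathcal{F}$. $d_{\mathcal{F}}(x)=|\{F\in\mathcal{F}:x\in F\}|$ and $\delta(\mathcal{F})=\min_{x\in[n]}d_{\mathcal{F}}(x)$. The weight of $x$ is $\omega_{\mathcal{F}}(x)=\sum_{x\in F\in\mathcal{F}}\frac{1}{|F|}$. For $1\le c\le d$, $\mathfrak{B}_c=\frac{2^d-c}{d}$ if $1\le c\le d-1$ and $\mathfrak{B}_d=\frac{2^d-d-\frac12}{d}$. *)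

(* Defs.v *)
From mathcomp Require Import all_boot all_order all_algebra.
Set Implicit Arguments. Unset Strict Implicit. Unset Printing Implicit Defensive.
Import Order.TTheory GRing.Theory Num.Theory.
Local Open Scope ring_scope.

Definition hereditary (n : nat) (Fam : {set {set 'I_n}}) : Prop :=
  forall F F' : {set 'I_n}, F \in Fam -> F' \subset F -> F' \in Fam.

Definition degree (n : nat) (Fam : {set {set 'I_n}}) (x : 'I_n) : nat :=
  #|[set F in Fam | x \in F]|.

Definition weight (n : nat) (Fam : {set {set 'I_n}}) (x : 'I_n) : rat :=
  \sum_(F in Fam | x \in F) (#|F|%:R)^-1.

Definition frakB (d c : nat) : rat :=
  if (c < d)%N then ((2 ^ d)%:R - c%:R) / d%:R
  else ((2 ^ d)%:R - d%:R - 1 / 2) / d%:R.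

(* Main.v *)
Require Import Defs.
From mathcomp Require Import all_boot all_order all_algebra.
From mathcomp Require Import zify ring lra.
Import Order.TTheory GRing.Theory Num.Theory.
Local Open Scope ring_scope.

(** Write k = d - 1 and let N[x] be the union of the members containing x.

    If |N[x]| > d, then the link of x is a hereditary family with at least 2^k - c + 1
    members and more than k vertices.  Splitting it at a vertex of minimum degree b and
    applying a Katona-type bound to the two parts (the sum of a nonincreasing function of
    the cardinality is least on the initial segment of the binary order) leaves an
    inequality about digit sums, which gives w(x) >= (2^d - c) / d.

    Otherwise |N[x]| = d, and B = N[x] is a block: at most c - 1 subsets of B through x are
    missing.  Let D be the family of complements in B of the missing sets; it is hereditary
    and |D| <= 2(c - 1).  If |D| <= c - 1, the members inside B already carry the required
    weight.  If |D| = c + j, a vertex v of D-degree at most j must lie in at least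
    j + 1 - deg_D(v) members that leave B, and D is too small to have few such vertices,
    so the weight outside B makes up for the loss.

    A vertex in at least two blocks has a weight exceeding the target by about
    2^(d-2) / d per block, so each vertex may share its excess equally among its blocks. *)

(** * Binary digit sums *)

(** Halving is not structural recursion, hence the fuel; any fuel at least [n] gives the same
    value. *)
Fixpoint pop_rec (fuel n : nat) : nat :=
  if fuel is f.+1 then (odd n + pop_rec f n./2)%N else 0%N.
Definition pop (n : nat) : nat := pop_rec n n.

Lemma pop_recE f g n : (n <= f)%N -> (n <= g)%N -> pop_rec f n = pop_rec g n.
Proof.
elim: f g n => [|f IH] [|g] n //=.
- by rewrite leqn0 => /eqP -> _; elim: g => //= g <-.
- by move=> _; rewrite leqn0 => /eqP ->; elim: f {IH} => //= f ->.
- by move=> nf ng; congr (_ + _)%N; apply: IH; lia.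
Qed.

Lemma popE n : pop n = (odd n + pop n./2)%N.
Proof.
case: n => // n; rewrite {1}/pop /=; congr (_ + _)%N.
by apply: pop_recE => /=; lia.
Qed.

Lemma pop_double n : pop n.*2 = pop n.
Proof. by rewrite popE odd_double doubleK. Qed.

Lemma pop_doubleS n : pop n.*2.+1 = (pop n).+1.
Proof. by rewrite popE /= odd_double /= uphalf_double. Qed.

Lemma half_ind (P : nat -> Prop) :
  P 0%N -> (forall n, (0 < n)%N -> P n -> P n.*2) -> (forall n, P n -> P n.*2.+1) ->
  forall n, P n.
Proof.
move=> P0 Pe Po; elim/ltn_ind => n IH; case: (posnP n) => [-> //|n0].
rewrite -(odd_double_half n); case: (boolP (odd n)) => on /=.
  by apply: Po; apply: IH; lia.
by apply: Pe; [move/negPf: on; lia | apply: IH; lia].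
Qed.

Lemma pop_succ_le n : (pop n.+1 <= (pop n).+1)%N.
Proof.
elim/half_ind: n => // n; first by rewrite pop_doubleS pop_double.
by rewrite -doubleS pop_double pop_doubleS => H; apply: leq_trans H _.
Qed.

Lemma pop_eq0 n : (pop n == 0)%N = (n == 0)%N.
Proof.
elim/half_ind: n => // n; last by rewrite pop_doubleS.
by rewrite pop_double => _ ->; case: n.
Qed.

Lemma pop_le j t : (t < 2 ^ j)%N -> (pop t <= j)%N.
Proof.
elim: j t => [|j IH] t; first by rewrite expn0 ltnS leqn0 => /eqP ->.
rewrite expnS => ht; rewrite popE.
have /IH : (t./2 < 2 ^ j)%N by lia.
by case: odd => /=; lia.
Qed.

Lemma pop_addpow j t : (t < 2 ^ j)%N -> pop (2 ^ j + t) = (pop t).+1.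
Proof.
elim: j t => [|j IH] t; first by rewrite expn0 ltnS leqn0 => /eqP ->.
rewrite expnS => ht; rewrite popE.
have -> : (2 * 2 ^ j + t)./2 = (2 ^ j + t./2)%N by rewrite mul2n halfD odd_double /= doubleK.
rewrite IH; last by lia.
by rewrite mul2n oddD odd_double /= addnS -popE.
Qed.

(** The map t -> 2^j - 1 - t flips all [j] binary digits. *)
Lemma pop_rev j t : (t < 2 ^ j)%N -> pop (2 ^ j - t.+1) = (j - pop t)%N.
Proof.
elim: j t => [|j IH] t; first by rewrite expn0 ltnS leqn0 => /eqP ->.
rewrite expnS => ht.
have h2 : (t./2 < 2 ^ j)%N by lia.
have hp := pop_le _ _ h2.
rewrite (popE t) -(odd_double_half t) in ht *; case: (odd t) ht => /=; rewrite ?add0n ?add1n => ht.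
  have -> : (2 * 2 ^ j - (t./2).*2.+2 = (2 ^ j - (t./2).+1).*2)%N by lia.
  by rewrite pop_double IH // uphalf_double; lia.
have -> : (2 * 2 ^ j - (t./2).*2.+1 = (2 ^ j - (t./2).+1).*2.+1)%N by lia.
by rewrite pop_doubleS IH // doubleK; lia.
Qed.

(** Reading [t] as the indicator of a finite set, this sums [phi] of the cardinality over the first
    [m] sets in binary order, the extremal configuration for [hereditary_sum_ge]. *)
Definition popsum (phi : nat -> rat) (m : nat) : rat :=
  \sum_(0 <= t < m) phi (pop t).

(** Effect on [phi] of restoring one vertex to every set of a link. *)
Definition sh (phi : nat -> rat) : nat -> rat := fun p => phi p.+1.

Definition noninc (phi : nat -> rat) : Prop := forall p, phi p.+1 <= phi p.

Lemma noninc_sh phi : noninc phi -> noninc (sh phi).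
Proof. by move=> H p; apply: H. Qed.

Lemma noninc_le phi p q : noninc phi -> (p <= q)%N -> phi q <= phi p.
Proof.
move=> H; elim: q => [|q IH]; first by rewrite leqn0 => /eqP ->.
rewrite leq_eqVlt => /orP[/eqP -> //|]; rewrite ltnS => /IH; apply: le_trans; exact: H.
Qed.

Lemma popsum0 phi : popsum phi 0 = 0.
Proof. by rewrite /popsum big_geq. Qed.

Lemma popsumS phi m : popsum phi m.+1 = popsum phi m + phi (pop m).
Proof. by rewrite /popsum big_nat_recr. Qed.

Lemma popsum_double phi m : popsum phi m.*2 = popsum phi m + popsum (sh phi) m.
Proof.
elim: m => [|m IH]; first by rewrite !popsum0 addr0.
by rewrite doubleS !popsumS IH pop_double pop_doubleS /sh; ring.
Qed.

Lemma popsum_doubleS phi m :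
  popsum phi m.*2.+1 = popsum phi m.+1 + popsum (sh phi) m.
Proof. by rewrite !popsumS popsum_double pop_double; ring. Qed.

Lemma popsum_split phi a b : (a <= b)%N ->
  popsum phi b = popsum phi a + \sum_(a <= t < b) phi (pop t).
Proof. by move=> ab; rewrite /popsum -(big_cat_nat _ ab). Qed.

Lemma popsum_addpow phi j b : (b <= 2 ^ j)%N ->
  popsum phi (2 ^ j + b) = popsum phi (2 ^ j) + popsum (sh phi) b.
Proof.
elim: b => [|b IH] hb; first by rewrite addn0 popsum0 addr0.
by rewrite addnS !popsumS pop_addpow // IH 1?ltnW // addrA.
Qed.

Lemma popsum_pow phi j :
  popsum phi (2 ^ j.+1) = popsum phi (2 ^ j) + popsum (sh phi) (2 ^ j).
Proof. by rewrite expnS mul2n -addnn popsum_addpow. Qed.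

Lemma popsum_rev phi j s : (s <= 2 ^ j)%N ->
  popsum phi (2 ^ j - s) = popsum phi (2 ^ j) - popsum (fun p => phi (j - p)%N) s.
Proof.
elim: s => [|s IH] hs; first by rewrite subn0 popsum0 subr0.
move: (IH (ltnW hs)); have -> : (2 ^ j - s = (2 ^ j - s.+1).+1)%N by lia.
by rewrite !popsumS pop_rev // => H; lra.
Qed.

Lemma popsum_ext phi psi j m : (m <= 2 ^ j)%N ->
  (forall p, (p <= j)%N -> phi p = psi p) -> popsum phi m = popsum psi m.
Proof.
move=> hm H; apply: eq_big_nat => t /andP[_ ht]; apply: H; apply: pop_le.
exact: leq_trans ht hm.
Qed.

Lemma popsum_lin phi psi m :
  popsum (fun p => phi p - psi p) m = popsum phi m - popsum psi m.
Proof. by rewrite /popsum big_split /= sumrN. Qed.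

(** Double counting of sets with a marked element: removing the mark leaves an arbitrary subset of
    the other [j - 1] elements. *)
Lemma popsum_cube_shift phi j : (0 < j)%N ->
  popsum (fun p => p%:R * phi p) (2 ^ j) = j%:R * popsum (sh phi) (2 ^ j.-1).
Proof.
case: j => // j _ /=; elim: j phi => [|j IH] phi.
  have [p0 p1] : pop 0 = 0%N /\ pop 1 = 1%N by [].
  by rewrite expn1 expn0 !popsumS !popsum0 p0 p1 /sh; ring.
rewrite popsum_pow IH.
have -> : popsum (sh (fun p => p%:R * phi p)) (2 ^ j.+1)
   = popsum (fun p => p%:R * sh phi p) (2 ^ j.+1) + popsum (sh phi) (2 ^ j.+1).
  rewrite /popsum -big_split /=; apply: eq_bigr => t _.
  by rewrite /sh -[in LHS]natr1; ring.
rewrite IH (popsum_pow (sh phi)) -[in RHS]natr1; ring.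
Qed.

(** Reciprocal size of a set of [p] vertices after [i] removed ones are restored. *)
Definition inv_from (i p : nat) : rat := ((p + i)%:R)^-1.

Lemma noninc_inv_from i : (0 < i)%N -> noninc (inv_from i).
Proof.
move=> i0 p; rewrite /inv_from lef_pV2 ?posrE ?ltr0n ?addn_gt0 ?i0 ?orbT //.
by rewrite ler_nat; lia.
Qed.

Lemma popsum_inv1_cube k :
  popsum (inv_from 1) (2 ^ k) = ((2 ^ k.+1)%:R - 1) / k.+1%:R.
Proof.
have := popsum_cube_shift (fun p => (p%:R)^-1) k.+1 isT; rewrite /=.
have -> : popsum (sh (fun p => p%:R^-1)) (2 ^ k) = popsum (inv_from 1) (2 ^ k).
  by apply: eq_bigr => t _; rewrite /sh /inv_from addn1.
(* Since [0^-1 = 0], the term at 0 vanishes and each of the others is 1. *)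
have -> : popsum (fun p => p%:R * p%:R^-1) (2 ^ k.+1) = (2 ^ k.+1)%:R - 1.
  have : (0 < 2 ^ k.+1)%N by rewrite expn_gt0.
  elim: (2 ^ k.+1)%N => // m IH _; rewrite popsumS.
  case: (posnP m) => [->|m0]; first by rewrite popsum0 /= mul0r addr0 subrr.
  by rewrite IH // mulfV ?pnatr_eq0 ?pop_eq0 -?lt0n // -natr1; ring.
by move=> ->; rewrite mulrC mulKf // pnatr_eq0.
Qed.

(** Separating even from odd numbers halves both segments, with [sh phi] governing the odd ones.
    This inequality recombines deletion and link in [hereditary_sum_ge]. *)
Lemma popsum_superadd phi a b : noninc phi -> (b <= a)%N ->
  popsum phi (a + b) <= popsum phi a + popsum (sh phi) b.
Proof.
move: {2}(a + b)%N (leqnn (a + b)) => n; elim: n phi a b => [|n IH] phi a b.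
  rewrite leqn0 addn_eq0 => /andP[/eqP -> /eqP ->] _ _.
  by rewrite !popsum0 addr0.
move=> hn Hphi hba.
case: (posnP b) => [->|b0]; first by rewrite addn0 popsum0 addr0.
have Hs := noninc_sh _ Hphi.
(* For [a = b = 1] the both-odd case would call the induction hypothesis at the same sum 2. *)
case: (eqVneq a 1%N) => [a1|a1].
  have b1 : b = 1%N by lia.
  by rewrite a1 b1 !popsumS !popsum0 !add0r.
move: hn hba b0 a1; rewrite -(odd_double_half a) -(odd_double_half b).
set a' := a./2; set b' := b./2.
case: (odd a) (odd b) => [] [] /=; rewrite ?add1n ?add0n => hn hba b0 a1.
- have -> : (a'.*2.+1 + b'.*2.+1 = (a' + b').+1.*2)%N by lia.
  rewrite popsum_double !popsum_doubleS.
  have h1 := IH phi a'.+1 b'.+1 ltac:(lia) Hphi ltac:(lia).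
  have h2 := IH (sh phi) a' b' ltac:(lia) Hs ltac:(lia).
  (* The induction hypotheses reach a' + b' + 2 and a' + b', whereas a' + b' + 1 is wanted twice;
     this compares the two stray terms. *)
  have h3 : phi (pop (a' + b')).+1 <= phi (pop (a' + b').+1).
    by apply: noninc_le => //; apply: pop_succ_le.
  move: h1; rewrite addSn addnS (popsumS phi (a' + b').+1) => h1.
  have h4 : popsum (sh phi) (a' + b').+1 =
    popsum (sh phi) (a' + b') + phi (pop (a' + b')).+1 by rewrite popsumS.
  lra.
- have -> : (a'.*2.+1 + b'.*2 = (a' + b').*2.+1)%N by lia.
  rewrite !popsum_double !popsum_doubleS.
  have h1 := IH phi a'.+1 b' ltac:(lia) Hphi ltac:(lia).
  have h2 := IH (sh phi) a' b' ltac:(lia) Hs ltac:(lia).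
  move: h1; rewrite addSn => h1; lra.
- have -> : (a'.*2 + b'.*2.+1 = (a' + b').*2.+1)%N by lia.
  rewrite !popsum_double !popsum_doubleS.
  have h1 := IH phi a' b'.+1 ltac:(lia) Hphi ltac:(lia).
  have h2 := IH (sh phi) a' b' ltac:(lia) Hs ltac:(lia).
  move: h1; rewrite addnS => h1; lra.
- have -> : (a'.*2 + b'.*2 = (a' + b').*2)%N by lia.
  rewrite !popsum_double.
  have h1 := IH phi a' b' ltac:(lia) Hphi ltac:(lia).
  have h2 := IH (sh phi) a' b' ltac:(lia) Hs ltac:(lia).
  lra.
Qed.

Lemma popsum_le phi psi m :
  (forall p, phi p <= psi p) -> popsum phi m <= popsum psi m.
Proof. by move=> H; apply: ler_sum. Qed.

(* Chebyshev's correlation inequality for the decreasing function [h \o pop]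
   and the initial segment. *)
Lemma popsum_avg h j b : noninc h -> (b <= 2 ^ j)%N ->
  b%:R * popsum h (2 ^ j) <= (2 ^ j)%:R * popsum h b.
Proof.
elim: j h b => [|j IH] h b Hh hb.
  move: hb; rewrite expn0 => hb; have [->|->] : b = 0%N \/ b = 1%N by lia.
    by rewrite mul0r popsum0 mulr0.
  by [].
have Hs := noninc_sh _ Hh.
have hA : popsum (sh h) (2 ^ j) <= popsum h (2 ^ j) by apply: popsum_le.
rewrite popsum_pow; set A := popsum h (2 ^ j) in hA *.
set A' := popsum (sh h) (2 ^ j) in hA *.
case: (leqP b (2 ^ j)) => hb2.
  have := IH h b Hh hb2; rewrite -/A expnS natrM => h1.
  have : b%:R * A' <= b%:R * A :> rat by apply: ler_wpM2l.
  by lra.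
have hb' : (b - 2 ^ j <= 2 ^ j)%N by rewrite expnS in hb; lia.
have := IH (sh h) _ Hs hb'; rewrite -/A'.
have -> : popsum h b = A + popsum (sh h) (b - 2 ^ j).
  by rewrite -popsum_addpow // subnKC // ltnW.
have : b%:R = (2 ^ j)%:R + (b - 2 ^ j)%:R :> rat by rewrite -natrD subnKC // ltnW.
rewrite expnS natrM => -> h1.
have : (b - 2 ^ j)%:R <= (2 ^ j)%:R :> rat by rewrite ler_nat.
set e := (b - 2 ^ j)%:R in h1 *; set N := (2 ^ j)%:R in h1 *; move=> eN.
have : 0 <= (N - e) * (A - A') by apply: mulr_ge0; lra.
by lra.
Qed.

(** [popsum_avg] for the function -p: the mean digit sum on an initial segment is at most the mean
    j/2 over the cube. *)
Lemma popsum_pop_le j m : (m <= 2 ^ j)%N ->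
  2 * popsum (fun p => p%:R) m <= m%:R * j%:R.
Proof.
move=> hm.
pose h (p : nat) : rat := - p%:R.
have Hh : noninc h by move=> p; rewrite /h lerN2 ler_nat.
have E l : popsum h l = - popsum (fun p => p%:R) l by rewrite /popsum sumrN.
have := popsum_avg h j m Hh hm; rewrite !E !mulrN lerN2.
have -> : popsum (fun p => p%:R) (2 ^ j) = j%:R * (2 ^ j)%:R / 2.
  case: j {hm} => [|j]; first by rewrite expn0 popsumS popsum0 /= !mul0r addr0.
  have := popsum_cube_shift (fun _ => 1) j.+1 isT; rewrite /=.
  have -> : popsum (sh (fun=> 1)) (2 ^ j) = (2 ^ j)%:R.
    by rewrite /popsum /sh big_const_nat subn0 iter_addr_0.
  have -> : popsum (fun p => p%:R * 1) (2 ^ j.+1) = popsum (fun p => p%:R) (2 ^ j.+1).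
    by apply: eq_bigr => t _; rewrite mulr1.
  by move=> ->; rewrite expnS natrM; field.
have : (0 : rat) < (2 ^ j)%:R by rewrite ltr0n expn_gt0.
set N := (2 ^ j)%:R; set S := popsum _ _ => N0 h1.
rewrite -(ler_pM2l N0); lra.
Qed.

(** * The merging inequality *)

(** Value of [inv_from 1] at the complement of a [p]-set in a [k]-set; it prices the sets absent
    from the end of the binary order. *)
Definition inv_codim (k p : nat) : rat := inv_from 1 (k - p).
(* Truncated subtraction makes [gap k] nonincreasing on all of [nat], not only up to [k]. *)
Definition gap (k p : nat) : rat := inv_from 2 p - inv_codim k p.

Lemma inv_from_le i p q : (0 < p + i)%N -> (p <= q)%N -> inv_from i q <= inv_from i p.
Proof.
move=> i0 pq; rewrite /inv_from lef_pV2 ?posrE ?ltr0n //; last by lia.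
by rewrite ler_nat; lia.
Qed.

Lemma inv_codim_le k p q : (p <= q)%N -> inv_codim k p <= inv_codim k q.
Proof. by move=> pq; apply: inv_from_le; lia. Qed.

Lemma noninc_gap k : noninc (gap k).
Proof.
move=> p; rewrite /gap lerB ?inv_codim_le //; exact: noninc_inv_from.
Qed.

Lemma gap_antisym k p : (p < k)%N -> gap k (k.-1 - p) = - gap k p.
Proof.
move=> pk; rewrite /gap /inv_codim /inv_from.
have -> : (k.-1 - p + 2 = k - p + 1)%N by lia.
have -> : (k - (k.-1 - p) + 1 = p + 2)%N by lia.
by rewrite opprB.
Qed.

(** By [gap_antisym] the sum over all of 2^(k-1) is zero, and cutting off the last [e] terms leaves
    the sum of the first [e]. This reflects large arguments to small ones. *)
Lemma popsum_gap_sym k e : (0 < k)%N -> (e <= 2 ^ k.-1)%N ->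
  popsum (gap k) (2 ^ k.-1 - e) = popsum (gap k) e.
Proof.
move=> k0.
have A b : (b <= 2 ^ k.-1)%N ->
  popsum (fun p => gap k (k.-1 - p)%N) b = - popsum (gap k) b.
  move=> hb; rewrite (@popsum_ext _ (fun p => - gap k p) k.-1) //; last first.
    by move=> p hp; apply: gap_antisym; lia.
  by rewrite /popsum sumrN.
move=> he; rewrite popsum_rev // A // opprK.
have := popsum_rev (gap k) k.-1 (2 ^ k.-1) (leqnn _).
rewrite subnn popsum0 A // => H; lra.
Qed.

(** Flipping [k - 2] digits turns [inv_codim k] into [inv_from 3], so the summand becomes 1/(x(x+1))
    with x = p + 2 <= k. *)
Lemma popsum_gap_cube k : (2 <= k)%N ->
  (2 ^ (k - 2))%:R / (k%:R * (k%:R + 1)) <= popsum (gap k) (2 ^ (k - 2)).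
Proof.
move=> k2.
have -> : popsum (gap k) (2 ^ (k - 2)) =
  popsum (fun p => inv_from 2 p - inv_from 3 p) (2 ^ (k - 2)).
  rewrite /gap !popsum_lin; congr (_ - _).
  have := popsum_rev (inv_codim k) (k - 2) (2 ^ (k - 2)) (leqnn _).
  rewrite subnn popsum0 => /esym/eqP; rewrite subr_eq0 => /eqP ->.
  apply: (@popsum_ext _ _ (k - 2)) => // p hp.
  by rewrite /inv_codim /inv_from; congr (_%:R^-1); lia.
have -> : (2 ^ (k - 2))%:R / (k%:R * (k%:R + 1)) =
  popsum (fun=> (k%:R * (k%:R + 1))^-1) (2 ^ (k - 2)) :> rat.
  by rewrite /popsum big_const_nat subn0 iter_addr_0 mulr_natl.
rewrite /popsum; apply: ler_sum_nat => t /andP[_ ht].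
have hp := pop_le _ _ ht; rewrite /inv_from.
have -> : ((pop t + 2)%:R^-1 - (pop t + 3)%:R^-1 : rat) =
  ((pop t + 2)%:R * ((pop t + 2)%:R + 1))^-1.
  have : (0 : rat) <= (pop t)%:R by [].
  by rewrite !natrD => P; field; apply/andP; split; lra.
have : (pop t + 2)%:R <= k%:R :> rat by rewrite ler_nat; lia.
have : (0 : rat) < (pop t + 2)%:R by rewrite ltr0n; lia.
move: ((pop t + 2)%:R : rat) => x x0 xk.
rewrite lef_pV2 ?posrE; [apply: ler_pM; lra | apply: mulr_gt0; lra..].
Qed.

Lemma popsum_gap_ge k b : (2 <= k)%N -> (b <= 2 ^ (k - 2))%N ->
  b%:R / (k%:R * (k%:R + 1)) <= popsum (gap k) b.
Proof.
move=> k2 hb.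
have := popsum_avg _ _ _ (noninc_gap k) hb.
have := popsum_gap_cube _ k2.
have : (0 : rat) < (2 ^ (k - 2))%:R by rewrite ltr0n expn_gt0.
set N := (2 ^ (k - 2))%:R; set S := popsum _ _; set C := (k%:R * _) => N0 h1 h2.
rewrite -(ler_pM2l N0); apply: le_trans h2.
have : b%:R * (N / C) <= b%:R * S by apply: ler_wpM2l.
by apply: le_trans; rewrite mulrCA.
Qed.

Lemma sum_inv_codim_le k j b s : (b + s <= 2 ^ j)%N ->
  \sum_(b <= t < b + s) inv_codim k (pop t) <= s%:R * inv_codim k j.
Proof.
move=> hb; apply: (@le_trans _ _ (\sum_(b <= t < b + s) inv_codim k j)).
  apply: ler_sum_nat => t /andP[_ ht]; apply: inv_codim_le.
  by apply: pop_le; apply: leq_trans ht hb.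
by rewrite big_const_nat addKn iter_addr_0 mulr_natl.
Qed.

(** The base case reads 130152 <= 131072. The value i = 16 is (k - 1)/3 for k = 49, that is d = 50,
    and 3i + 3 bounds [k] in [cube_le_pow_third]. *)
Lemma cube_le_pow i : (16 <= i)%N ->
  ((3 * i + 3) * (3 * i + 3) * (3 * i + 2) + 2 * (3 * i + 3) <= 2 * 2 ^ i)%N.
Proof.
move=> hi; rewrite -(subnKC hi); elim: (i - 16)%N => [|m IH]; first by lia.
rewrite addnS expnS.
apply: (@leq_trans (2 * ((3 * (16 + m) + 3) * (3 * (16 + m) + 3) * (3 * (16 + m) + 2)
   + 2 * (3 * (16 + m) + 3)))); first by nia.
by rewrite mulnCA leq_mul2l IH orbT.
Qed.

Lemma cube_le_pow_third k : (49 <= k)%N ->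
  (k * k * (k - 1) + 2 * k <= 2 * 2 ^ ((k - 1) %/ 3))%N.
Proof.
move=> hk; have := cube_le_pow ((k - 1) %/ 3).
have hi : (16 <= (k - 1) %/ 3)%N by lia.
have : (k <= 3 * ((k - 1) %/ 3) + 3)%N by lia.
move: hi; set i := (_ %/ _)%N => hi h /(_ hi); apply: leq_trans.
apply: leq_add; last by lia.
by apply: leq_mul; [apply: leq_mul | lia].
Qed.

Lemma biquad_le_pow k : (49 <= k)%N -> (k * k * (k - 1) * (k + 1) <= 2 ^ k)%N.
Proof.
move=> hk; rewrite -(subnKC hk); elim: (k - 49)%N => [|m IH]; first by lia.
rewrite addnS expnS; move: IH.
have -> : (49 + m - 1 = 48 + m)%N by lia.
have -> : ((49 + m).+1 - 1 = 49 + m)%N by lia.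
move=> IH; apply: (@leq_trans (2 * ((49 + m) * (49 + m) * (48 + m) * (49 + m + 1)))).
  by nia.
by rewrite leq_mul2l IH orbT.
Qed.

Lemma gap_ge0 k p : (2 * p + 1 <= k)%N -> 0 <= gap k p.
Proof.
move=> h; rewrite /gap subr_ge0 /inv_codim /inv_from.
rewrite lef_pV2 ?posrE ?ltr0n ?ler_nat; lia.
Qed.

(* Here every digit sum is at most k / 3, so [gap k 0] alone suffices. *)
Lemma gap_main_low k s b : (49 <= k)%N -> (s <= k)%N -> (1 <= b)%N ->
  (b + s <= 2 ^ ((k - 1) %/ 3))%N ->
  \sum_(b <= t < b + s) inv_codim k (pop t) - s%:R / (k%:R + 1) <= popsum (gap k) b.
Proof.
move=> hk hs hb hbs; have := sum_inv_codim_le k _ _ _ hbs.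
have hj : (3 * ((k - 1) %/ 3) + 1 <= k)%N by lia.
move: hbs hj; set j := (_ %/ _)%N => hbs hj hS.
have hlow : gap k 0 <= popsum (gap k) b.
  rewrite (popsum_split _ _ _ hb) /popsum big_nat1 lerDl.
  rewrite big_nat_cond; apply: sumr_ge0 => t /andP[/andP[_ ht] _].
  apply: gap_ge0; have : (pop t <= j)%N by apply: pop_le; lia.
  lia.
apply: le_trans hlow; apply: (@le_trans _ _ (s%:R * inv_codim k j - s%:R / (k%:R + 1))).
  by rewrite lerD2r.
rewrite /gap /inv_codim /inv_from subn0 add0n.
have -> : (k - j + 1)%:R = k%:R - j%:R + 1 :> rat by rewrite natrD natrB //; lia.
rewrite natrD.
have : s%:R <= k%:R :> rat by rewrite ler_nat.
have : 3 * j%:R + 1 <= k%:R :> rat by rewrite -natrM natr1 ler_nat; lia.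
have : 0 <= s%:R :> rat by [].
have : 0 <= j%:R :> rat by [].
have : 49 <= k%:R :> rat by rewrite ler_nat.
move: (k%:R : rat) (s%:R : rat) (j%:R : rat) => K S J K49 J0 S0 JK SK.
have -> : S * (K - J + 1)^-1 - S / (K + 1) = (2 * S * J) / (2 * (K - J + 1) * (K + 1)).
  by field; apply/andP; split; lra.
have -> : 2^-1 - (K + 1)^-1 = ((K - 1) * (K - J + 1)) / (2 * (K - J + 1) * (K + 1)).
  by field; apply/andP; split; lra.
apply: ler_wpM2r; last by nra.
by rewrite invr_ge0; apply: mulr_ge0; lra.
Qed.

(** Digit sums below 2^(k-1) are at most k - 1, so each term is at most 1/2; the bound s(1/2 -
    1/(k+1)) is largest at s = k. *)
Lemma gap_main_mid k s b : (49 <= k)%N -> (s <= k)%N ->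
  (b + s <= 2 ^ k.-1)%N ->
  \sum_(b <= t < b + s) inv_codim k (pop t) - s%:R / (k%:R + 1)
    <= k%:R * (k%:R - 1) / (2 * (k%:R + 1)).
Proof.
move=> hk hs hbs; have := sum_inv_codim_le k _ _ _ hbs.
rewrite {2}/inv_codim /inv_from.
have -> : (k - k.-1 + 1 = 2)%N by lia.
set S := \sum_(_ <= _ < _) _ => hS.
apply: (@le_trans _ _ (s%:R * (2^-1 - (k%:R + 1)^-1))); first by rewrite mulrBr lerD2r.
have : s%:R <= k%:R :> rat by rewrite ler_nat.
have : 49 <= k%:R :> rat by rewrite ler_nat.
move: (k%:R : rat) (s%:R : rat) => K s' K49 sK.
have -> : K * (K - 1) / (2 * (K + 1)) = K * (2^-1 - (K + 1)^-1) by field; lra.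
apply: ler_wpM2r; last exact: sK.
by rewrite subr_ge0 lef_pV2 ?posrE; lra.
Qed.

(** The cubic condition makes the bound b/(k(k+1)) of [popsum_gap_ge] reach the ceiling in
    [gap_main_mid]. *)
Lemma popsum_gap_big k b : (49 <= k)%N -> (b <= 2 ^ (k - 2))%N ->
  (k * k * (k - 1) <= 2 * b)%N ->
  k%:R * (k%:R - 1) / (2 * (k%:R + 1)) <= popsum (gap k) b.
Proof.
move=> hk hb hkb; apply: le_trans (popsum_gap_ge _ _ _ hb); last by lia.
have : k%:R * k%:R * (k%:R - 1) <= 2 * b%:R :> rat.
  by move: hkb; rewrite -(ler_nat rat) !natrM natrB //; lia.
have : 49 <= k%:R :> rat by rewrite ler_nat.
move: (k%:R : rat) (b%:R : rat) => K B K49 h.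
have -> : K * (K - 1) / (2 * (K + 1)) = (K * K * (K - 1) / 2) / (K * (K + 1)).
  by field; apply/andP; split; lra.
apply: ler_wpM2r; last by lra.
by rewrite invr_ge0; apply: mulr_ge0; lra.
Qed.

(** Three ranges of [b]: small [b] by [gap_main_low], then up to 2^(k-2) by averaging, and beyond by
    reflection to 2^(k-1) - b. The upper bound on [b] keeps the reflected value at least
    2^(k-1)/(k+1). *)
Lemma gap_main k s b : (49 <= k)%N -> (s <= k)%N -> (1 <= b)%N ->
  (2 * (k + 1) * b <= 2 ^ k * k)%N ->
  \sum_(b <= t < b + s) inv_codim k (pop t) - s%:R / (k%:R + 1) <= popsum (gap k) b.
Proof.
move=> hk hs hb hbk.
case: (leqP (b + s) (2 ^ ((k - 1) %/ 3))) => hbs; first exact: gap_main_low.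
have hc := cube_le_pow_third _ hk.
have hq := biquad_le_pow _ hk.
have e1 : (2 ^ k = 2 * 2 ^ k.-1)%N by rewrite -expnS prednK //; lia.
have e2 : (2 ^ k.-1 = 2 * 2 ^ (k - 2))%N by rewrite -expnS; congr (2 ^ _)%N; lia.
have kcube : (k * k * k <= k * k * (k - 1) * (k + 1))%N.
  by rewrite -!mulnA !leq_mul2l; apply/orP; right; apply/orP; right; nia.
have he : (2 ^ k.-1 <= (k + 1) * (2 ^ k.-1 - b))%N.
  have h : ((k + 1) * b <= 2 ^ k.-1 * k)%N.
    by rewrite -(@leq_pmul2l 2) // !mulnA -e1.
  by rewrite mulnBr mulnDl mul1n (mulnC k) addnC -addnBA // leq_addr.
have hb1 : (b < 2 ^ k.-1)%N.
  have : (0 < 2 ^ k.-1)%N by rewrite expn_gt0.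
  by move: he; case: (ltnP b (2 ^ k.-1)) => // /eqP ->; rewrite muln0; lia.
have hebig : (k * k * (k - 1) <= 2 * (2 ^ k.-1 - b))%N.
  rewrite -(@leq_pmul2r (k + 1)); last by rewrite addn1.
  apply: leq_trans hq _.
  rewrite e1; move: he; set E := (_ - _)%N => he.
  by rewrite -mulnA (mulnC E) leq_mul2l.
have hse : (b + s <= 2 ^ k.-1)%N.
  have : (k * (2 * 1) <= k * (k * (k - 1)))%N.
    by rewrite leq_mul2l leq_mul ?orbT //; lia.
  rewrite mulnA => h2k.
  by lia.
apply: le_trans (gap_main_mid _ _ _ hk hs hse) _.
case: (leqP b (2 ^ (k - 2))) => hb2.
  by apply: popsum_gap_big => //; lia.
rewrite -(popsum_gap_sym k b) ; [|lia|lia].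
by apply: popsum_gap_big => //; lia.
Qed.

(** By [popsum_rev] the absent s + b sets cost [inv_codim k] on the first s + b numbers. The first
    [b] of these pair with [inv_from 2] into [gap k]; [gap_main] absorbs the other [s]. *)
Lemma popsum_merge_bound k s b : (49 <= k)%N -> (s <= k)%N -> (1 <= b)%N ->
  (2 * (k + 1) * b <= 2 ^ k * k)%N -> (s + b <= 2 ^ k)%N ->
  ((2 ^ k.+1)%:R - 1 - s%:R) / (k%:R + 1) <=
  popsum (inv_from 1) (2 ^ k - (s + b)) + popsum (inv_from 2) b.
Proof.
move=> hk hs hb hbk hsb; have := gap_main _ _ _ hk hs hb hbk.
rewrite popsum_rev // popsum_inv1_cube -natr1 -/(inv_codim k).
rewrite (@popsum_split _ b (s + b)) ?leq_addl // /gap popsum_lin (addnC s) .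
set A := popsum _ b; set B := popsum _ b; set C := \sum_(_ <= _ < _) _.
by rewrite !mulrBl; lra.
Qed.

(** * Hereditary families and links *)

Definition link {n : nat} (Fam : {set {set 'I_n}}) (z : 'I_n) : {set {set 'I_n}} :=
  [set G : {set 'I_n} | (z \notin G) && (z |: G \in Fam)].

Definition deletion {n : nat} (Fam : {set {set 'I_n}}) (z : 'I_n) : {set {set 'I_n}} :=
  [set F in Fam | z \notin F].

Definition vertices {n : nat} (Fam : {set {set 'I_n}}) : {set 'I_n} :=
  [set z | [set z] \in Fam].

Lemma sum_link n (Fam : {set {set 'I_n}}) z (phi : {set 'I_n} -> rat) :
  \sum_(F in Fam | z \in F) phi F = \sum_(G in link Fam z) phi (z |: G).
Proof.
rewrite (reindex_onto (fun G => z |: G) (fun F => F :\ z)) /=; last first.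
  by move=> F /andP[_ zF]; rewrite setD1K.
apply: eq_bigl => G; rewrite !inE eqxx andbT andbC.
case: (boolP (z \in G)) => zG /=; last by rewrite setU1K ?eqxx.
apply/negbTE; rewrite negb_and; apply/orP; left; apply/eqP => E.
by move: zG; rewrite -E !inE eqxx.
Qed.

Lemma degreeE n (Fam : {set {set 'I_n}}) z :
  (degree Fam z)%:R = \sum_(F in Fam | z \in F) 1 :> rat.
Proof.
rewrite /degree -sum1_card natr_sum; apply: eq_bigl => F.
by rewrite inE.
Qed.

Lemma card_link n (Fam : {set {set 'I_n}}) z : #|link Fam z| = degree Fam z.
Proof.
apply/eqP; rewrite -(eqr_nat rat) degreeE sum_link -sum1_card natr_sum.
by apply/eqP; apply: eq_bigr.
Qed.

Lemma weight_link n (Fam : {set {set 'I_n}}) z :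
  weight Fam z = \sum_(G in link Fam z) inv_from 1 #|G|.
Proof.
rewrite /weight sum_link; apply: eq_bigr => G; rewrite inE => /andP[zG _].
by rewrite cardsU1 zG addnC.
Qed.

Lemma hereditary_link n (Fam : {set {set 'I_n}}) z :
  hereditary Fam -> hereditary (link Fam z).
Proof.
move=> H F F'; rewrite !inE => /andP[zF FF] FF'.
rewrite (H _ _ FF) ?setUS // andbT.
by apply: contraNN zF => /(subsetP FF').
Qed.

Lemma hereditary_deletion n (Fam : {set {set 'I_n}}) z :
  hereditary Fam -> hereditary (deletion Fam z).
Proof.
move=> H F F'; rewrite !inE => /andP[FF zF] FF'.
rewrite (H _ _ FF) //=.
by apply: contraNN zF => /(subsetP FF').
Qed.

Lemma link_sub_deletion n (Fam : {set {set 'I_n}}) z :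
  hereditary Fam -> link Fam z \subset deletion Fam z.
Proof.
move=> H; apply/subsetP => F; rewrite !inE => /andP[-> FF]; rewrite andbT.
by apply: H FF _; apply: subsetUr.
Qed.

Lemma sum_split_link n (Fam : {set {set 'I_n}}) z (phi : nat -> rat) :
  \sum_(F in Fam) phi #|F| =
  \sum_(F in deletion Fam z) phi #|F| + \sum_(G in link Fam z) sh phi #|G|.
Proof.
rewrite (bigID (fun F : {set 'I_n} => z \in F)) /= addrC; congr (_ + _).
  by apply: eq_bigl => F; rewrite inE.
rewrite sum_link; apply: eq_bigr => G; rewrite inE => /andP[zG _].
by rewrite cardsU1 zG.
Qed.

Lemma card_split_link n (Fam : {set {set 'I_n}}) z :
  #|Fam| = (#|deletion Fam z| + #|link Fam z|)%N.
Proof.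
apply/eqP; rewrite -(eqr_nat rat) natrD -!sum1_card !natr_sum.
by rewrite (sum_split_link _ _ z (fun=> 1)).
Qed.

(** Induction on the number of covered vertices, splitting at one of them. The link is contained in
    the deletion, which gives the side condition of [popsum_superadd]. *)
Lemma hereditary_sum_ge n (Fam : {set {set 'I_n}}) (phi : nat -> rat) :
  hereditary Fam -> noninc phi -> popsum phi #|Fam| <= \sum_(F in Fam) phi #|F|.
Proof.
have [m] := ubnP #|cover Fam|; elim: m Fam phi => // m IH Fam phi hm HF Hphi.
case: (set_0Vmem (cover Fam)) => [E|[z zF]].
  have sub : Fam \subset [set set0].
    apply/subsetP => F FF; rewrite inE -subset0 -E; exact: (bigcup_sup F).
  have := subset_leq_card sub; rewrite cards1.
  move: sub; rewrite subset1 => /orP[]/eqP -> _.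
    by rewrite cards1 big_set1 cards0 popsumS popsum0 add0r.
  by rewrite cards0 big_set0 popsum0.
have cov (A : {set {set 'I_n}}) : A \subset deletion Fam z -> (#|cover A| < m)%N.
  move=> sA; rewrite ltnS in hm; apply: leq_trans hm.
  rewrite (cardsD1 z (cover Fam)) zF; apply: subset_leq_card.
  apply/bigcupsP => F /(subsetP sA); rewrite inE => /andP[FF zF'].
  by rewrite subsetD1 zF' (bigcup_sup F).
have Hd := hereditary_deletion _ _ z HF.
have Hl := hereditary_link _ _ z HF.
have sl := link_sub_deletion _ _ z HF.
rewrite (sum_split_link _ _ z) (card_split_link _ _ z).
apply: le_trans (popsum_superadd _ _ _ Hphi (subset_leq_card sl)) _.
apply: lerD; apply: IH => //; try exact: noninc_sh; exact: cov.
Qed.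

(** Keeping the two parts apart, instead of merging them by [popsum_superadd], retains the gain from
    a vertex of low degree. *)
Lemma hereditary_sum_ge_split n (Fam : {set {set 'I_n}}) (phi : nat -> rat) z :
  hereditary Fam -> noninc phi ->
  popsum phi (#|Fam| - degree Fam z) + popsum (sh phi) (degree Fam z)
    <= \sum_(F in Fam) phi #|F|.
Proof.
move=> HF Hphi; rewrite (sum_split_link _ _ z) -card_link (card_split_link _ _ z) addnK.
apply: lerD; apply: hereditary_sum_ge => //.
- exact: hereditary_deletion.
- exact: hereditary_link.
- exact: noninc_sh.
Qed.

Lemma weight_ge n (Fam : {set {set 'I_n}}) z :
  hereditary Fam -> popsum (inv_from 1) (degree Fam z) <= weight Fam z.
Proof.
move=> HF; rewrite weight_link -card_link; apply: hereditary_sum_ge.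
  exact: hereditary_link.
exact: noninc_inv_from.
Qed.

Lemma sum_incidence n (Fam : {set {set 'I_n}}) (A : {set 'I_n}) (phi : {set 'I_n} -> rat) :
  \sum_(z in A) \sum_(F in Fam | z \in F) phi F = \sum_(F in Fam) #|A :&: F|%:R * phi F.
Proof.
rewrite (exchange_big_dep (mem Fam)) /=; last by move=> z F _ /andP[].
apply: eq_bigr => F FF; rewrite (eq_bigl (mem (A :&: F))).
  by rewrite sumr_const mulr_natl.
by move=> z; rewrite FF !inE.
Qed.

Lemma sum_degree n (Fam : {set {set 'I_n}}) (A : {set 'I_n}) :
  \sum_(z in A) (degree Fam z)%:R = \sum_(F in Fam) #|A :&: F|%:R :> rat.
Proof.
under eq_bigr do rewrite degreeE.
by rewrite sum_incidence; apply: eq_bigr => F _; rewrite mulr1.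
Qed.

Lemma hereditary_sum_card_le n (Fam : {set {set 'I_n}}) q :
  hereditary Fam -> (#|Fam| <= 2 ^ q)%N ->
  2 * \sum_(F in Fam) #|F|%:R <= #|Fam|%:R * q%:R :> rat.
Proof.
move=> HF hq; apply: le_trans (popsum_pop_le _ _ hq).
rewrite ler_pM2l //.
have Hphi : noninc (fun p => - p%:R) by move=> p; rewrite lerN2 ler_nat.
have := hereditary_sum_ge _ _ _ HF Hphi.
by rewrite /popsum !sumrN lerN2.
Qed.

Lemma sum_degree_le n (Fam : {set {set 'I_n}}) (A : {set 'I_n}) q :
  hereditary Fam -> (#|Fam| <= 2 ^ q)%N ->
  2 * \sum_(z in A) (degree Fam z)%:R <= #|Fam|%:R * q%:R :> rat.
Proof.
move=> HF hq; apply: le_trans (hereditary_sum_card_le _ _ _ HF hq).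
rewrite ler_pM2l // sum_degree; apply: ler_sum => F _.
by rewrite ler_nat subset_leq_card ?subsetIr.
Qed.

(** The degrees sum to at most |Fam| k / 2 over at least k + 1 vertices, so some degree is at most
    the average. *)
Lemma exists_low_degree n (Fam : {set {set 'I_n}}) k :
  hereditary Fam -> (#|Fam| <= 2 ^ k)%N -> (k < #|vertices Fam|)%N ->
  exists2 z, z \in vertices Fam & (2 * (k + 1) * degree Fam z <= #|Fam| * k)%N.
Proof.
move=> HF hq hV.
case: (boolP [exists z in vertices Fam, 2 * (k + 1) * degree Fam z <= #|Fam| * k]%N).
  by case/exists_inP => z zV hz; exists z.
rewrite negb_exists_in => /forall_inP H.
have := sum_degree_le _ _ (vertices Fam) _ HF hq.
have : (k + 1)%:R * (#|Fam| * k)%:R <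
   (2 * (k + 1))%:R * \sum_(z in vertices Fam) (degree Fam z)%:R :> rat.
  rewrite mulr_sumr; apply: (@lt_le_trans _ _ (\sum_(z in vertices Fam) ((#|Fam| * k)%:R + 1))).
    rewrite sumr_const -[X in _ < X]mulr_natl; apply: (@lt_le_trans _ _ ((k + 1)%:R * ((#|Fam| * k)%:R + 1))).
      by rewrite ltr_pM2l ?ltrDl // ltr0n addn1.
    by apply: ler_wpM2r; [rewrite addr_ge0 | rewrite ler_nat addn1].
  apply: ler_sum => z /H; rewrite -ltnNge => hz.
  by rewrite -natrM natr1 ler_nat.
rewrite (natrM _ 2) natrM -(mulrA 2) (mulrCA 2) ltr_pM2l ?ltr0n ?addn1 // => h1 h2.
lra.
Qed.

Lemma hereditary_weight_ge n (L : {set {set 'I_n}}) k s :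
  (49 <= k)%N -> (s <= k)%N -> hereditary L -> (2 ^ k - s < #|L| + 1)%N ->
  (k < #|vertices L|)%N ->
  ((2 ^ k.+1)%:R - 1 - s%:R) / (k%:R + 1) <= \sum_(G in L) inv_from 1 #|G|.
Proof.
move=> hk sk HL hL hV.
have Hphi := noninc_inv_from 1 isT.
have k0 : (0 : rat) < k%:R + 1 by rewrite natr1 ltr0n.
(* With at least 2^k members the unsplit bound suffices. *)
case: (leqP (2 ^ k) #|L|) => hLk.
  apply: le_trans (hereditary_sum_ge _ _ _ HL Hphi).
  rewrite (popsum_split _ _ _ hLk) popsum_inv1_cube -natr1.
  rewrite -[leLHS]addr0; apply: lerD.
    rewrite ler_pM2r ?invr_gt0 //.
    by have : (0 : rat) <= s%:R by []; lra.
  by apply: sumr_ge0 => t _; rewrite /inv_from invr_ge0.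
have [z zV hz] := exists_low_degree _ _ _ HL (ltnW hLk) hV.
have z1 : (1 <= degree L z)%N.
  rewrite /degree card_gt0; apply/set0Pn; exists [set z]; rewrite !inE eqxx andbT.
  by move: zV; rewrite inE.
have zle : (degree L z <= #|L|)%N by rewrite -card_link (card_split_link _ L z) leq_addl.
set s' := (2 ^ k - #|L|)%N.
have hs' : (s' <= s)%N by rewrite /s'; lia.
apply: le_trans (hereditary_sum_ge_split _ _ _ z HL Hphi).
have -> : popsum (sh (inv_from 1)) (degree L z) = popsum (inv_from 2) (degree L z).
  by apply: eq_bigr => t _; rewrite /sh /inv_from addSnnS.
have -> : (#|L| - degree L z = 2 ^ k - (s' + degree L z))%N by rewrite /s'; lia.
apply: le_trans (popsum_merge_bound k s' (degree L z) hk _ z1 _ _).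
- by rewrite ler_pM2r ?invr_gt0 // lerD2l lerN2 ler_nat.
- by apply: leq_trans hs' sk.
- by apply: leq_trans hz _; rewrite leq_mul2r ltnW ?orbT.
- by rewrite /s'; lia.
Qed.

(** * Blocks *)

(** A closed neighbourhood: y = x is included as soon as the singleton of [x] is a member. For a
    hereditary family it is the union of the members through [x]. *)
Definition nbhd {n : nat} (Fam : {set {set 'I_n}}) (x : 'I_n) : {set 'I_n} :=
  [set y | [set x; y] \in Fam].

Definition inside {n : nat} (Fam : {set {set 'I_n}}) (B : {set 'I_n}) : {set {set 'I_n}} :=
  [set F in Fam | F \subset B].

Definition missing {n : nat} (Fam : {set {set 'I_n}}) (B A : {set 'I_n}) : {set {set 'I_n}} :=
  [set F : {set 'I_n} | [&& A \subset F, F \subset B & F \notin Fam]].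

(* The missing subsets of [B] form an up-set; passing to complements turns it into a
   hereditary family. *)
Definition codual {n : nat} (Fam : {set {set 'I_n}}) (B : {set 'I_n}) : {set {set 'I_n}} :=
  [set C : {set 'I_n} | (C \subset B) && (B :\: C \notin Fam)].

Lemma sub_nbhd n (Fam : {set {set 'I_n}}) x F :
  hereditary Fam -> F \in Fam -> x \in F -> F \subset nbhd Fam x.
Proof.
move=> HF FF xF; apply/subsetP => y yF; rewrite inE; apply: HF FF _.
by apply/subsetP => z; rewrite !inE => /orP[] /eqP ->.
Qed.

Lemma mem_nbhd_self n (Fam : {set {set 'I_n}}) x :
  hereditary Fam -> (0 < degree Fam x)%N -> x \in nbhd Fam x.
Proof.
move=> HF; rewrite /degree card_gt0 => /set0Pn[F]; rewrite inE => /andP[FF xF].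
by apply: (subsetP (sub_nbhd _ _ _ _ HF FF xF)).
Qed.

Lemma card_vertices_link n (Fam : {set {set 'I_n}}) x :
  x \in nbhd Fam x -> (#|vertices (link Fam x)| + 1)%N = #|nbhd Fam x|.
Proof.
move=> xN; rewrite (cardsD1 x (nbhd _ _)) xN addnC; congr (_ + _)%N.
apply: eq_card => z; rewrite !inE; congr (_ && _).
by rewrite eq_sym.
Qed.

Lemma card_interval (T : finType) (A B : {set T}) : A \subset B ->
  #|[set F : {set T} | (A \subset F) && (F \subset B)]| = (2 ^ (#|B| - #|A|))%N.
Proof.
move=> AB; rewrite -cardsDS // -card_powerset.
rewrite -(@card_in_imset _ _ (fun F : {set T} => F :\: A)).
  apply: eq_card => F; rewrite inE; apply/imsetP/idP.
    by case=> G; rewrite inE => /andP[AG GB] ->; apply: setSD.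
  rewrite subsetD => /andP[FB FA]; exists (A :|: F).
    by rewrite inE subsetUl subUset AB FB.
  by rewrite setDUl setDv set0U; apply/esym/setDidPl.
move=> F G; rewrite !inE => /andP[AF _] /andP[AG _] E.
by rewrite -(setID F A) -(setID G A) E !(setIidPr _).
Qed.

Lemma card_missing n (Fam : {set {set 'I_n}}) (B A : {set 'I_n}) : A \subset B ->
  (#|[set F in Fam | (A \subset F) && (F \subset B)]| + #|missing Fam B A|)%N
   = (2 ^ (#|B| - #|A|))%N.
Proof.
move=> AB; rewrite -card_interval // -[RHS](cardsID Fam).
by congr (_ + _)%N; apply: eq_card => F; rewrite !inE;
  case: (A \subset F) (F \subset B) (F \in Fam) => [] [] [].
Qed.

Lemma missing_sub n (Fam : {set {set 'I_n}}) (B A A' : {set 'I_n}) :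
  A' \subset A -> missing Fam B A \subset missing Fam B A'.
Proof.
by move=> AA; apply/subsetP => F; rewrite !inE => /and3P[AF -> ->]; rewrite (subset_trans AA).
Qed.

(** Every member through [x] lies in its neighbourhood, so members and missing sets together exhaust
    the subsets of it through [x]. *)
Lemma degree_missing n (Fam : {set {set 'I_n}}) x : hereditary Fam -> x \in nbhd Fam x ->
  (degree Fam x + #|missing Fam (nbhd Fam x) [set x]|)%N = (2 ^ (#|nbhd Fam x|).-1)%N.
Proof.
move=> HF xN; have := @card_missing _ Fam (nbhd Fam x) [set x].
rewrite sub1set => /(_ xN); rewrite cards1 subn1 => <-; congr (_ + _)%N.
apply: eq_card => F; rewrite !inE sub1set; case: (boolP (F \in Fam)) => //= FF.
by case: (boolP (x \in F)) => // xF; rewrite sub_nbhd.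
Qed.

Lemma degree_inside_missing n (Fam : {set {set 'I_n}}) (B : {set 'I_n}) v : v \in B ->
  (degree (inside Fam B) v + #|missing Fam B [set v]|)%N = (2 ^ (#|B|).-1)%N.
Proof.
move=> vB; have := @card_missing _ Fam B [set v].
rewrite sub1set => /(_ vB); rewrite cards1 subn1 => <-.
congr (_ + _)%N; apply: eq_card => F; rewrite !inE sub1set.
by rewrite -andbA; congr (_ && _); rewrite andbC.
Qed.

Lemma hereditary_inside n (Fam : {set {set 'I_n}}) (B : {set 'I_n}) :
  hereditary Fam -> hereditary (inside Fam B).
Proof.
move=> H F F'; rewrite !inE => /andP[FF FB] FF'.
by rewrite (H _ _ FF) // (subset_trans FF').
Qed.

Lemma hereditary_codual n (Fam : {set {set 'I_n}}) (B : {set 'I_n}) :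
  hereditary Fam -> hereditary (codual Fam B).
Proof.
move=> H F F'; rewrite !inE => /andP[FB FF] FF'.
rewrite (subset_trans FF') //=; apply: contraNN FF => F'F.
by apply: H F'F _; apply: setDS.
Qed.

Lemma setDKs (T : finType) (B C : {set T}) : C \subset B -> B :\: (B :\: C) = C.
Proof. by move=> CB; rewrite setDDr setDv set0U; apply/setIidPr. Qed.

Lemma card_deletion_codual n (Fam : {set {set 'I_n}}) (B : {set 'I_n}) v : v \in B ->
  #|deletion (codual Fam B) v| = #|missing Fam B [set v]|.
Proof.
move=> vB; rewrite -(@card_in_imset _ _ (fun F : {set 'I_n} => B :\: F)).
  apply: eq_card => F; rewrite !inE sub1set; apply/imsetP/idP.
    case=> C; rewrite !inE => /andP[/andP[CB CF] vC] ->.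
    by rewrite !inE vC vB subsetDl.
  move=> /and3P[vF FB FF]; exists (B :\: F); last by rewrite setDKs.
  by rewrite !inE subsetDl setDKs // FF vF.
move=> C C'; rewrite !inE => /andP[/andP[CB _] _] /andP[/andP[CB' _] _] E.
by rewrite -(setDKs _ _ _ CB) E setDKs.
Qed.

Lemma card_codual n (Fam : {set {set 'I_n}}) (B : {set 'I_n}) :
  (#|inside Fam B| + #|codual Fam B|)%N = (2 ^ #|B|)%N.
Proof.
have := @card_missing _ Fam B set0 (sub0set B); rewrite cards0 subn0 => <-.
congr (_ + _)%N; first by apply: eq_card => F; rewrite !inE sub0set.
rewrite -(@card_in_imset _ _ (fun F : {set 'I_n} => B :\: F)).
  apply: eq_card => F; rewrite !inE sub0set /=; apply/imsetP/idP.
    by case=> C; rewrite !inE => /andP[CB CF] ->; rewrite subsetDl.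
  move=> /andP[FB FF]; exists (B :\: F); last by rewrite setDKs.
  by rewrite !inE subsetDl setDKs.
move=> C C'; rewrite !inE => /andP[CB _] /andP[CB' _] E.
by rewrite -(setDKs _ _ _ CB) E setDKs.
Qed.

(** A nonempty member F gives 1/|F| to at most |F| vertices of [A], hence at most 1; the empty set
    gives nothing. *)
Lemma sum_weight_le n (Fam : {set {set 'I_n}}) (A : {set 'I_n}) : set0 \in Fam ->
  \sum_(z in A) weight Fam z <= #|Fam|%:R - 1.
Proof.
move=> F0; rewrite /weight sum_incidence (bigD1 set0) //= setI0 cards0 mul0r add0r.
rewrite (cardsD1 set0 Fam) F0 natrD addrAC subrr add0r -sum1_card natr_sum.
rewrite (eq_bigl (mem (Fam :\ set0))); last by move=> F; rewrite !inE andbC.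
apply: ler_sum => F; rewrite !inE -card_gt0 => /andP[c0 _].
by rewrite ler_pdivrMr ?ltr0n // mul1r ler_nat subset_leq_card // subsetIr.
Qed.

Lemma sum_weight_inside n (Fam : {set {set 'I_n}}) (B : {set 'I_n}) : set0 \in Fam ->
  \sum_(z in B) weight (inside Fam B) z = #|inside Fam B|%:R - 1.
Proof.
move=> F0; have F0' : set0 \in inside Fam B by rewrite inE F0 sub0set.
rewrite /weight sum_incidence (bigD1 set0) //= setI0 cards0 mul0r add0r.
rewrite (cardsD1 set0 (inside _ _)) F0' natrD addrAC subrr add0r -sum1_card natr_sum.
rewrite (eq_bigl (mem (inside Fam B :\ set0))); last by move=> F; rewrite !inE andbC.
apply: eq_bigr => F; rewrite !inE -card_gt0 => /and3P[c0 _ /setIidPr ->].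
by rewrite mulfV // pnatr_eq0 -lt0n.
Qed.

Definition outer_weight {n : nat} (Fam : {set {set 'I_n}}) (B : {set 'I_n}) (v : 'I_n) : rat :=
  \sum_(F in Fam | (v \in F) && ~~ (F \subset B)) (#|F|%:R)^-1.

Lemma weight_split n (Fam : {set {set 'I_n}}) (B : {set 'I_n}) v :
  weight Fam v = weight (inside Fam B) v + outer_weight Fam B v.
Proof.
rewrite /weight (bigID (fun F : {set 'I_n} => F \subset B)) /=; congr (_ + _).
  by apply: eq_bigl => F; rewrite inE andbAC.
by apply: eq_bigl => F; rewrite andbA.
Qed.

Lemma degree_split n (Fam : {set {set 'I_n}}) (B : {set 'I_n}) v :
  degree Fam v = (degree (inside Fam B) v
    + #|[set F in Fam | (v \in F) && ~~ (F \subset B)]|)%N.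
Proof.
rewrite /degree -[LHS](cardsID (inside Fam B)); congr (_ + _)%N; apply: eq_card => F.
  by rewrite !inE; case: (F \in Fam); rewrite ?andbF // andbC.
by rewrite !inE; case: (F \in Fam) => //=; rewrite andbC.
Qed.

Lemma popsum_mono phi a b : (forall p, 0 <= phi p) -> (a <= b)%N ->
  popsum phi a <= popsum phi b.
Proof. by move=> H ab; rewrite (popsum_split _ _ _ ab) lerDl sumr_ge0. Qed.

Lemma inv_from_ge0 i p : 0 <= inv_from i p.
Proof. by rewrite /inv_from invr_ge0. Qed.

Lemma outer_weight_ge0 n (Fam : {set {set 'I_n}}) (B : {set 'I_n}) v : 0 <= outer_weight Fam B v.
Proof. by apply: sumr_ge0 => F _; rewrite invr_ge0. Qed.

(** Pick z in F outside B. Every subset of F through v and z is a member leaving B, so the double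
    link at v and z has at least 2^(|F|-2) members, each two vertices smaller than the member it
    stands for. *)
Lemma outer_weight_ge n (Fam : {set {set 'I_n}}) (B : {set 'I_n}) v F : hereditary Fam -> v \in B ->
  F \in Fam -> v \in F -> ~~ (F \subset B) ->
  popsum (inv_from 2) (2 ^ (#|F| - 2)) <= outer_weight Fam B v.
Proof.
move=> HF vB FF vF /subsetPn[z zF zB].
have vz : v != z by apply: contraNneq zB => <-.
pose M := link (link Fam v) z.
have HM : hereditary M by do 2 apply: hereditary_link.
have cM : (2 ^ (#|F| - 2) <= #|M|)%N.
  rewrite (cardsD1 v F) vF (cardsD1 z (F :\ v)) !inE eq_sym vz zF /= addnA addKn.
  rewrite -card_powerset subset_leq_card //; apply/subsetP => G; rewrite inE.
  move=> /subsetP GF; have nG y : y \in G -> [&& y != z, y != v & y \in F].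
    by move/GF; rewrite !inE.
  have vG : v \notin G by apply/negP => /nG; rewrite eqxx andbF.
  have zG : z \notin G by apply/negP => /nG; rewrite eqxx.
  rewrite !inE zG (negPf vz) (negPf vG) /=; apply: HF FF _.
  by apply/subsetP => y; rewrite !inE => /or3P[/eqP -> // | /eqP -> // | /nG /and3P[]].
apply: le_trans (popsum_mono _ _ _ (inv_from_ge0 2) cM) _.
apply: le_trans (hereditary_sum_ge _ _ _ HM (noninc_inv_from 2 isT)) _.
have -> : \sum_(G in M) inv_from 2 #|G| =
   \sum_(H in Fam | (v \in H) && (z \in H)) (#|H|%:R)^-1.
  rewrite [RHS](eq_bigl (fun H => ((H \in Fam) && (v \in H)) && (z \in H))); last first.
    by move=> H; rewrite andbA.
  rewrite big_mkcondr /= sum_link -big_mkcondr /=.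
  rewrite [RHS](eq_bigl (fun G => (G \in link Fam v) && (z \in G))); last first.
    by move=> G; rewrite !inE eq_sym (negPf vz).
  rewrite sum_link; apply: eq_bigr => G; rewrite !inE negb_or => /and3P[zG /andP[_ vG] _].
  by rewrite !cardsU1 !inE negb_or vz vG zG /inv_from addnC addnA.
rewrite /outer_weight [leRHS](bigID (fun H : {set 'I_n} => z \in H)) /=.
rewrite -[leLHS]addr0; apply: lerD; last by apply: sumr_ge0 => H _; rewrite invr_ge0.
rewrite le_eqVlt; apply/orP; left; apply/eqP; apply: eq_bigl => H.
case: (boolP (z \in H)) => zH; rewrite ?andbF // !andbT.
suff -> : ~~ (H \subset B) by rewrite andbT.
by apply/subsetPn; exists z.
Qed.

(** * Weight leaving a block *)

Definition high_degree {n : nat} (D : {set {set 'I_n}}) (B : {set 'I_n}) (r : nat) : {set 'I_n} :=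
  [set v in B | (r <= degree D v)%N].

(** Counts high-degree vertices through their weight, for use when [r] is small;
    [card_high_degree_log] uses the mean member size instead and serves larger [r]. *)
Lemma card_high_degree n (D : {set {set 'I_n}}) (B : {set 'I_n}) r :
  hereditary D -> set0 \in D ->
  #|high_degree D B r|%:R * popsum (inv_from 1) r <= #|D|%:R - 1.
Proof.
move=> HD D0; apply: le_trans (sum_weight_le _ _ (high_degree D B r) D0).
rewrite mulr_natl -sumr_const; apply: ler_sum => v; rewrite inE => /andP[_ hv].
by apply: le_trans (weight_ge _ _ v HD); apply: popsum_mono => //; apply: inv_from_ge0.
Qed.

Lemma card_high_degree_log n (D : {set {set 'I_n}}) (B : {set 'I_n}) r q :
  hereditary D -> (#|D| <= 2 ^ q)%N ->
  2 * (#|high_degree D B r|%:R * r%:R) <= #|D|%:R * q%:R :> rat.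
Proof.
move=> HD hq; apply: le_trans (sum_degree_le _ _ (high_degree D B r) _ HD hq).
rewrite ler_pM2l // mulr_natl -sumr_const; apply: ler_sum => v.
by rewrite inE ler_nat => /andP[].
Qed.

(** A linear bound on the logarithm of 2d is enough and keeps the later inequalities polynomial in
    [d] and [j]. *)
Lemma log_bound d : (50 <= d)%N -> exists2 q, (2 * d <= 2 ^ q)%N & (8 * q <= d + 6)%N.
Proof.
move=> hd; exists ((d + 6) %/ 8)%N; last by lia.
have h7 : (7 <= (d + 6) %/ 8)%N by lia.
have : (2 * d <= 16 * ((d + 6) %/ 8) + 2)%N by lia.
move: h7; set q := (_ %/ _)%N => h7 h; apply: leq_trans h _.
rewrite -(subnKC h7); elim: (q - 7)%N => [|m IH]; first by lia.
rewrite addnS expnS; apply: (@leq_trans (2 * (16 * (7 + m) + 2))); first by lia.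
by rewrite leq_mul2l IH orbT.
Qed.

Lemma sum_ge_low n (B : {set 'I_n}) (D : {set {set 'I_n}}) (out : 'I_n -> rat) r a :
  (forall v, v \in B -> 0 <= out v) ->
  (forall v, v \in B -> (degree D v < r)%N -> a <= out v) ->
  (#|B|%:R - #|high_degree D B r|%:R) * a <= \sum_(v in B) out v.
Proof.
move=> H0 Ha; rewrite (bigID (mem (high_degree D B r))) /=.
have -> : #|B|%:R - #|high_degree D B r|%:R = #|B :\: high_degree D B r|%:R :> rat.
  have := cardsID (high_degree D B r) B; rewrite (setIidPr _); last first.
    by apply/subsetP => v; rewrite inE => /andP[].
  by move=> <-; rewrite natrD addrAC subrr add0r.
rewrite -[leLHS]add0r; apply: lerD; first by apply: sumr_ge0 => v /andP[vB _]; apply: H0.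
rewrite (eq_bigl (mem (B :\: high_degree D B r))); last by move=> v; rewrite !inE andbC.
rewrite mulr_natl -sumr_const; apply: ler_sum => v; rewrite !inE negb_and -ltnNge.
by case: (boolP (v \in B)) => //= vB /andP[h _]; apply: Ha.
Qed.

(** For [j] between about d/8 and 3d/10: [h] counts high-degree vertices and each of the others
    supplies 1/2. *)
Lemma num_mid (d j h : rat) : 50 <= d -> d <= 8 * j + 3 -> 10 * j <= 3 * d -> 0 <= h ->
  16 * (h * (j + 1)) <= (d + j) * (d + 6) -> j + 1 <= (d - h) * 2^-1.
Proof.
move=> d50 j1 j2 h0 H.
suff : h <= d - 2 * (j + 1) by lra.
have jp : 0 < 16 * (j + 1) by lra.
rewrite -(ler_pM2l jp).
apply: (@le_trans _ _ ((d + j) * (d + 6))); first by lra.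
(* Nonnegative products of hypotheses, of which the remaining quadratic inequality is a linear
   consequence. *)
have : 0 <= (8 * j + 3 - d) * (3 * d - 10 * j) by apply: mulr_ge0; lra.
have : 0 <= (d - 50) * (8 * j + 3 - d) by apply: mulr_ge0; lra.
have : 0 <= (d - 50) * (3 * d - 10 * j) by apply: mulr_ge0; lra.
have : 0 <= (d - 50) * (d - 50) by apply: mulr_ge0; lra.
lra.
Qed.

(** For [j] from 3d/10 on: low degree now means below j - 2, and each such vertex supplies 17/12. *)
Lemma num_high (d j h : rat) : 50 <= d -> j + 2 <= d -> 3 * d <= 10 * j -> 0 <= h ->
  16 * (h * (j - 2)) <= (d + j) * (d + 6) -> j + 1 <= (d - h) * (17 / 12).
Proof.
move=> d50 j1 j2 h0 H.
suff : h <= d - 12 / 17 * (j + 1) by lra.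
have jp : 0 < 16 * (j - 2) by lra.
rewrite -(ler_pM2l jp).
apply: (@le_trans _ _ ((d + j) * (d + 6))); first by lra.
have : 0 <= (d - 2 - j) * (10 * j - 3 * d) by apply: mulr_ge0; lra.
have : 0 <= (d - 50) * (d - 2 - j) by apply: mulr_ge0; lra.
have : 0 <= (d - 50) * (10 * j - 3 * d) by apply: mulr_ge0; lra.
have : 0 <= (d - 50) * (d - 50) by apply: mulr_ge0; lra.
lra.
Qed.

Lemma popsum_inv1_two : popsum (inv_from 1) 2 = 3 / 2.
Proof.
rewrite !popsumS popsum0 /inv_from.
by rewrite -[(pop 0 + 1)%N]/1%N -[(pop 1 + 1)%N]/2%N; field.
Qed.

Lemma popsum_inv2_four : popsum (inv_from 2) (2 ^ 2) = 17 / 12.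
Proof.
rewrite !popsumS popsum0 /inv_from -[(pop 0 + 2)%N]/2%N -[(pop 1 + 2)%N]/3%N.
by rewrite -[(pop 3 + 2)%N]/4%N; field.
Qed.

(** When |D| = c + j the members inside the block fall short of the target by j + 1, or by j + 1/2
    if c = d. Four ranges of [j] balance the number of low-degree vertices against what each
    supplies. *)
Lemma codual_excess n (D : {set {set 'I_n}}) (B : {set 'I_n}) (out : 'I_n -> rat) d c j :
  (50 <= d)%N -> (c <= d)%N -> #|B| = d -> hereditary D ->
  #|D| = (c + j)%N -> (j + 2 <= c)%N ->
  (forall v, v \in B -> 0 <= out v) ->
  (forall v, v \in B -> (degree D v < j.+1)%N -> 2^-1 <= out v) ->
  (forall v, v \in B -> (degree D v < j - 2)%N -> 17 / 12 <= out v) ->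
  j%:R + (if (c < d)%N then 1 else 2^-1) <= \sum_(v in B) out v.
Proof.
move=> d50 cd cB HD cD jc H0 Hhalf Hbig.
have D0 : set0 \in D.
  have : (0 < #|D|)%N by rewrite cD; lia.
  by rewrite card_gt0 => /set0Pn[F FD]; apply: HD FD (sub0set F).
have Rj0 : (0 : rat) <= j%:R by [].
have Rcd : c%:R <= d%:R :> rat by rewrite ler_nat.
have Rd : 50 <= d%:R :> rat by rewrite (ler_nat _ 50).
have Rjc : j%:R + 2 <= c%:R :> rat by rewrite -natrD ler_nat.
have Hlow := sum_ge_low _ B D out _ _ H0 Hhalf.
rewrite cB in Hlow.
(* At most c - 1 vertices have positive degree, so at least d - c + 1 have degree 0 and supply 1/2
   each: two or more if c < d, but only one is guaranteed if c = d. Hence the 1/2 in the value for c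
   = d. *)
case: (posnP j) => [j0|j1].
  have := card_high_degree _ _ B j.+1 HD D0; rewrite cD j0 addn0.
  rewrite popsumS popsum0 add0r /inv_from add0n invr1 mulr1 => h1.
  apply: le_trans Hlow; rewrite j0 add0r; case: (ltnP c d) => hcd; last by lra.
  have : c%:R + 1 <= d%:R :> rat by rewrite natr1 ler_nat.
  by lra.
apply: (@le_trans _ _ (j%:R + 1)); first by case: ifP => _; lra.
(* A high-degree vertex has weight at least 1 + 1/2, so there are at most 2(d + j - 1)/3 of them;
   then (d - 2j + 2)/6 >= j + 1 amounts to 8j + 4 <= d. *)
case: (leqP (8 * j + 4) d) => hj8.
  apply: le_trans Hlow.
  have := card_high_degree _ _ B j.+1 HD D0; rewrite cD natrD.
  have : (0 : rat) <= #|high_degree D B j.+1|%:R by [].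
  have : 3 / 2 <= popsum (inv_from 1) j.+1.
    rewrite -popsum_inv1_two; apply: popsum_mono; first exact: inv_from_ge0.
    by lia.
  have : 8 * j%:R + 4 <= d%:R :> rat by rewrite -natrM -natrD ler_nat.
  set h := #|_|%:R; set p := popsum _ _ => h8 p32 h0 hp.
  have : h * (3 / 2) <= h * p by apply: ler_wpM2l.
  by lra.
have [q hq1 hq2] := log_bound _ d50.
have Rq : 8 * q%:R <= d%:R + 6 :> rat by rewrite -natrM -natrD ler_nat.
have cD' : (#|D| <= 2 ^ q)%N by apply: leq_trans hq1; rewrite cD; lia.
have Rq0 : (0 : rat) <= q%:R by [].
have Rhigh r : 16 * (#|high_degree D B r|%:R * r%:R) <= (d%:R + j%:R) * (d%:R + 6) :> rat.
  have := card_high_degree_log _ _ B r _ HD cD'; rewrite cD natrD => h.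
  have : (c%:R + j%:R) * (8 * q%:R) <= (d%:R + j%:R) * (d%:R + 6) :> rat.
    apply: ler_pM; [by rewrite -natrD ler0n | by rewrite -natrM ler0n | | exact: Rq].
    by rewrite lerD2r.
  by lra.
have Rj8 : d%:R <= 8 * j%:R + 3 :> rat.
  by rewrite -natrM -natrD ler_nat -ltnS -addnS.
case: (leqP (10 * j) (3 * d)) => hj10.
  apply: le_trans Hlow; apply: (num_mid _ _ _ Rd Rj8 _ (ler0n _ _)).
    by rewrite -!natrM ler_nat.
  by rewrite natr1; apply: Rhigh.
have := sum_ge_low _ B D out _ _ H0 Hbig; rewrite cB; apply: le_trans.
have Rjd : j%:R + 2 <= d%:R :> rat by apply: le_trans Rjc Rcd.
apply: (num_high _ _ _ Rd Rjd _ (ler0n _ _)).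
  by rewrite -!natrM ler_nat ltnW.
have j2 : (2 <= j)%N by clear -d50 hj10; lia.
by have := Rhigh (j - 2)%N; rewrite (natrB _ j2).
Qed.

Lemma outer_weight_ge_half n (Fam : {set {set 'I_n}}) (B : {set 'I_n}) v :
  hereditary Fam -> v \in B -> (degree (inside Fam B) v < degree Fam v)%N ->
  2^-1 <= outer_weight Fam B v.
Proof.
move=> HF vB; rewrite (degree_split _ Fam B) -[X in (X < _)%N]addn0 ltn_add2l card_gt0.
case/set0Pn=> F; rewrite inE => /and3P[FF vF FB].
apply: le_trans (outer_weight_ge _ _ _ _ _ HF vB FF vF FB).
apply: le_trans (popsum_mono _ 1 _ (inv_from_ge0 2) _); last by rewrite expn_gt0.
by rewrite popsumS popsum0 add0r lexx.
Qed.

(** A leaving member of size at least 4 gives 1/2 + 1/3 + 1/3 + 1/4 = 17/12. Otherwise one of the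
    four or more leaving members is a pair and three others have at most three elements, giving 1/2
    + 3/3. *)
Lemma outer_weight_ge_big n (Fam : {set {set 'I_n}}) (B : {set 'I_n}) v :
  hereditary Fam -> v \in B -> (degree (inside Fam B) v + 4 <= degree Fam v)%N ->
  17 / 12 <= outer_weight Fam B v.
Proof.
move=> HF vB; rewrite (degree_split _ Fam B) leq_add2l.
set O := [set F in Fam | _] => hO.
case: (boolP [exists F in O, 4 <= #|F|]%N) => [/exists_inP[F]|].
  rewrite inE => /and3P[FF vF FB] h4.
  apply: le_trans (outer_weight_ge _ _ _ _ _ HF vB FF vF FB).
  rewrite -popsum_inv2_four; apply: popsum_mono; [exact: inv_from_ge0 | rewrite leq_exp2l //; lia].
rewrite negb_exists_in => /forall_inP Hs.
have outE : outer_weight Fam B v = \sum_(F in O) (#|F|%:R)^-1.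
  by apply: eq_bigl => F; rewrite inE.
have : (0 < #|O|)%N by lia.
rewrite card_gt0 => /set0Pn[F]; rewrite inE => /and3P[FF vF /subsetPn[z zF zB]].
have vz : v != z by apply: contraNneq zB => <-.
have vzO : [set v; z] \in O.
  rewrite !inE eqxx /=; apply/andP; split.
    by apply: HF FF _; apply/subsetP => y; rewrite !inE => /orP[]/eqP ->.
  by apply/subsetPn; exists z => //; rewrite !inE eqxx orbT.
have c2 : #|[set v; z]| = 2%N by rewrite cards2 vz.
rewrite outE (bigD1 [set v; z] vzO) /= c2.
have : (3 : rat) <= #|O :\ [set v; z]|%:R.
  by rewrite (ler_nat _ 3); move: hO; rewrite (cardsD1 [set v; z] O) vzO.
have : #|O :\ [set v; z]|%:R * 3^-1 <= \sum_(F in O | F != [set v; z]) (#|F|%:R)^-1 :> rat.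
  rewrite [leRHS](eq_bigl (mem (O :\ [set v; z]))); last by move=> G; rewrite !inE andbC.
  rewrite mulr_natl -sumr_const; apply: ler_sum => G; rewrite !inE => /andP[_ GO].
  have G0 : (0 < #|G|)%N by apply/card_gt0P; exists v; case/and3P: GO.
  have : (#|G| <= 3)%N by have := Hs G; rewrite inE => /(_ GO); rewrite -ltnNge.
  by move=> G3; rewrite lef_pV2 ?posrE ?ltr0n // (ler_nat _ _ 3).
set S := \sum_(_ in _ | _) _; move=> h1 h2; lra.
Qed.

(** * Overlapping blocks *)

(** For m = k - 1 the left side is 2(k+1)((k+1)^2 + k) + k, as needed in [weight_multi]. *)
Lemma quartic_lt_pow m : (48 <= m)%N ->
  (2 * (m + 2) * ((m + 2) * (m + 2) + m + 1) + m + 1 <= 2 ^ m)%N.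
Proof.
move=> hm; rewrite -(subnKC hm); elim: (m - 48)%N => [|l IH]; first by lia.
rewrite addnS expnS.
apply: (@leq_trans (2 * (2 * (48 + l + 2) * ((48 + l + 2) * (48 + l + 2) + (48 + l) + 1)
  + (48 + l) + 1))); first by nia.
by rewrite leq_mul2l IH orbT.
Qed.

Lemma frakB_le k c : (1 <= c <= k.+1)%N ->
  frakB k.+1 c <= ((2 ^ k.+1)%:R - 1 - c.-1%:R) / (k%:R + 1).
Proof.
move=> /andP[c1 ck]; rewrite /frakB -(@natr1 _ k).
have k0 : (0 : rat) < k%:R + 1 by rewrite natr1 ltr0n.
have -> : c.-1%:R = c%:R - 1 :> rat by rewrite -subn1 natrB.
case: ltnP => h; rewrite ler_pM2r ?invr_gt0 //; first by lra.
have -> : c = k.+1 by apply/eqP; rewrite eqn_leq ck h.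
by rewrite -(@natr1 _ k); lra.
Qed.

Lemma popsum_inv1_lower k s : (s <= 2 ^ k)%N ->
  ((2 ^ k.+1)%:R - 1) / (k%:R + 1) - s%:R <= popsum (inv_from 1) (2 ^ k - s).
Proof.
move=> hs; rewrite popsum_rev // popsum_inv1_cube -natr1 lerD2l lerN2.
rewrite /popsum; apply: (@le_trans _ _ (\sum_(0 <= t < s) 1)).
  apply: ler_sum => t _; rewrite /inv_from invf_le1 ?ltr0n ?addn1 //.
  by rewrite (ler_nat _ 1).
by rewrite big_const_nat subn0 iter_addr_0.
Qed.

Lemma linear_lt_pow k : (49 <= k)%N -> (2 * (k + 1) < 2 ^ (k - 2))%N.
Proof.
move=> hk; have hm : (48 <= k.-1)%N by lia.
have := quartic_lt_pow _ hm.
have -> : (2 ^ k.-1 = 2 * 2 ^ (k - 2))%N by rewrite -expnS; congr (2 ^ _)%N; lia.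
set P := (2 ^ (k - 2))%N; set q := ((k.-1 + 2) * _ + _ + _)%N => h.
have : (k.-1 + 2 <= (k.-1 + 2) * q)%N by rewrite leq_pmulr // /q addn1.
by lia.
Qed.

(** * Consequences of the degree condition, with d = k + 1 *)

Section DegreeCondition.
Variables (n k c : nat) (Fam : {set {set 'I_n}}).
Hypotheses (hk : (49 <= k)%N) (hc : (1 <= c <= k.+1)%N) (HF : hereditary Fam).
Hypothesis (Hdeg : forall x : 'I_n, (2 ^ k - c + 1 <= degree Fam x)%N).

Let pow_gt := linear_lt_pow _ hk.
Let T : rat := frakB k.+1 c.

Lemma in_nbhd x : x \in nbhd Fam x.
Proof. by apply: mem_nbhd_self => //; have := Hdeg x; lia. Qed.

(** A neighbourhood of at most [k] vertices admits at most 2^(k-1) members through [x], below the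
    required degree. *)
Lemma card_nbhd_ge x : (k.+1 <= #|nbhd Fam x|)%N.
Proof.
rewrite leqNgt; apply/negP => h.
have := degree_missing _ _ _ HF (in_nbhd x); have := Hdeg x; have := pow_gt.
have : (2 ^ (#|nbhd Fam x|).-1 <= 2 ^ k.-1)%N by rewrite leq_exp2l //; lia.
have e1 : (2 ^ k = 2 * 2 ^ k.-1)%N by rewrite -expnS prednK //; lia.
have e2 : (2 ^ k.-1 = 2 * 2 ^ (k - 2))%N by rewrite -expnS; congr (2 ^ _)%N; lia.
by lia.
Qed.

Lemma weight_large_nbhd x : #|nbhd Fam x| != k.+1 -> T <= weight Fam x.
Proof.
move=> hx; apply: le_trans (frakB_le _ _ hc) _; rewrite weight_link.
have hx' : (k.+1 < #|nbhd Fam x|)%N by rewrite ltn_neqAle eq_sym hx card_nbhd_ge.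
apply: hereditary_weight_ge => //.
- by lia.
- exact: hereditary_link.
- by rewrite card_link; have := Hdeg x; have := pow_gt; lia.
- by have := card_vertices_link _ _ _ (in_nbhd x); lia.
Qed.

Lemma weight_lower x : T - k%:R <= weight Fam x.
Proof.
apply: le_trans (weight_ge _ _ x HF).
have h : (c.-1 <= 2 ^ k)%N by have := pow_gt; have : (2 ^ (k - 2) <= 2 ^ k)%N; [rewrite leq_exp2l //|]; lia.
have h' : (2 ^ k - c.-1 <= degree Fam x)%N by have := Hdeg x; lia.
apply: le_trans (popsum_mono _ _ _ (inv_from_ge0 1) h').
apply: le_trans (popsum_inv1_lower _ _ h).
apply: lerB; last by rewrite ler_nat; lia.
apply: le_trans (frakB_le _ _ hc) _; rewrite ler_pM2r ?invr_gt0 ?natr1 ?ltr0n //.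
by rewrite gerBl.
Qed.

Definition centre (x : 'I_n) : bool := #|nbhd Fam x| == k.+1.

Lemma missing_centre x : centre x -> (#|missing Fam (nbhd Fam x) [set x]| < c)%N.
Proof.
move=> /eqP E; have := degree_missing _ _ _ HF (in_nbhd x); rewrite E /=.
by have := Hdeg x; lia.
Qed.

(** If z in N[x'] were not adjacent to x, all subsets of N[x'] through x', x and z would be missing,
    at least 2^(k-2) > c - 1 of them. Hence a centre lies in no block but its own. *)
Lemma nbhd_eq x x' : centre x -> centre x' -> x \in nbhd Fam x' -> nbhd Fam x = nbhd Fam x'.
Proof.
move=> Cx Cx' xx'; apply/esym/eqP; rewrite eqEcard (eqP Cx) (eqP Cx') leqnn andbT.
apply/subsetP => z zx'; rewrite inE; apply/negPn/negP => xz.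
pose A := [set x'; x; z].
have AB : A \subset nbhd Fam x'.
  by apply/subsetP => y; rewrite !inE -orbA => /or3P[]/eqP ->;
     [move: (in_nbhd x') | move: xx' | move: zx']; rewrite inE.
have cA : (#|A| <= 3)%N.
  by rewrite /A setUC cardsU1 (leq_trans (leq_add (leq_b1 _) (leqnn _))) // cards2 !ltnS leq_b1.
have := missing_centre _ Cx'; rewrite ltnNge => /negP; apply.
have sub : [set F : {set 'I_n} | (A \subset F) && (F \subset nbhd Fam x')]
   \subset missing Fam (nbhd Fam x') [set x'].
  apply/subsetP => F; rewrite !inE sub1set => /andP[AF ->] /=.
  rewrite (subsetP AF) ?inE ?eqxx //=; apply: contra xz => FF; apply: HF FF _.
  by apply: subset_trans AF; rewrite /A -setUA subsetUr.
apply: leq_trans (subset_leq_card sub); rewrite card_interval // (eqP Cx').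
apply: (@leq_trans (2 ^ (k - 2))); first by have := pow_gt; lia.
by rewrite leq_exp2l //; apply: leq_trans (leq_sub2l _ cA); lia.
Qed.

Lemma codegree_centre x v : centre x -> v \in nbhd Fam x ->
  (2 ^ k.-1 - k <= #|[set F in Fam | (v \in F) && (x \in F)]|)%N.
Proof.
move=> Cx vx; have AB : [set x; v] \subset nbhd Fam x.
  by apply/subsetP => y; rewrite !inE => /orP[]/eqP ->; [move: (in_nbhd x) | move: vx]; rewrite inE.
have E := card_missing _ Fam _ _ AB; have hm := missing_centre _ Cx.
have hs := subset_leq_card (missing_sub _ Fam (nbhd Fam x) [set x; v] [set x] (subsetUl _ _)).
have hp : (2 ^ k.-1 <= 2 ^ (#|nbhd Fam x| - #|[set x; v]|))%N.
  by rewrite (eqP Cx) leq_exp2l // cards2; case: (x != v) => /=; lia.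
have hF : (#|[set F in Fam | ([set x; v] \subset F) && (F \subset nbhd Fam x)]|
   <= #|[set F in Fam | (v \in F) && (x \in F)]|)%N.
  apply: subset_leq_card; apply/subsetP => F; rewrite !inE => /and3P[-> /subsetP xvF _] /=.
  by rewrite !xvF // !inE eqxx ?orbT.
rewrite leq_subLR; apply: leq_trans hp _; rewrite -E addnC; apply: leq_add => //.
apply: leq_trans hs _; rewrite -ltnS; apply: leq_trans hm _; by case/andP: hc.
Qed.

(** Members of the codual avoiding [x] are complements of missing sets through [x], at most c - 1;
    those through [x] are no more numerous, since the link is contained in the deletion. *)
Lemma card_codual_centre x : centre x -> (#|codual Fam (nbhd Fam x)| + 2 <= 2 * c)%N.
Proof.
move=> Cx; rewrite (card_split_link _ _ x).
have := subset_leq_card (link_sub_deletion _ _ x (hereditary_codual _ _ (nbhd Fam x) HF)).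
have := missing_centre _ Cx; rewrite -(card_deletion_codual _ _ _ _ (in_nbhd x)).
move: (deletion _ _) (link _ _) => X Y hX hY.
have := leq_ltn_trans hY hX; move: hX; move: #|X| #|Y| => a b; lia.
Qed.

(** Missing sets through [v] correspond to members of the codual D avoiding [v], so the inside
    degree falls short of 2^k by |D| - deg_D(v). *)
Lemma degree_inside_codual (B : {set 'I_n}) v : v \in B -> #|B| = k.+1 ->
  (degree (inside Fam B) v + #|codual Fam B| = 2 ^ k + degree (codual Fam B) v)%N.
Proof.
move=> vB cB; have := degree_inside_missing _ Fam _ _ vB; rewrite cB /=.
rewrite -card_deletion_codual // (card_split_link _ (codual Fam B) v) card_link.
by lia.
Qed.

(** Every nonempty member inside B contributes exactly 1, so the inside weight totals 2^d - |D| - 1;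
    the outer weight must cover any shortfall. *)
Lemma block_weight x : centre x ->
  k.+1%:R * T <= \sum_(v in nbhd Fam x) weight Fam v.
Proof.
move=> Cx; set B := nbhd Fam x.
have cB : #|B| = k.+1 by apply/eqP.
have F0 : set0 \in Fam.
  by move: (in_nbhd x); rewrite inE => h; apply: HF h (sub0set _).
have -> : \sum_(v in B) weight Fam v =
   #|inside Fam B|%:R - 1 + \sum_(v in B) outer_weight Fam B v.
  rewrite -sum_weight_inside // -big_split /=; apply: eq_bigr => v _.
  exact: weight_split.
have cD := card_codual _ Fam B; rewrite cB in cD.
have -> : #|inside Fam B|%:R = (2 ^ k.+1)%:R - #|codual Fam B|%:R :> rat.
  by rewrite -cD natrD addrK.
have c2 := card_codual_centre _ Cx; rewrite -/B in c2.
have k0 : (k.+1%:R : rat) != 0 by rewrite pnatr_eq0.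
have TE : k.+1%:R * T = (2 ^ k.+1)%:R - (if (c < k.+1)%N then c%:R else c%:R + 1 / 2).
  rewrite /T /frakB; case: ltnP => h; rewrite mulrC divfK //.
  have -> : c = k.+1 by apply/eqP; rewrite eqn_leq h andbT; case/andP: hc.
  by ring.
have Hout v : v \in B -> 0 <= outer_weight Fam B v by move=> _; apply: outer_weight_ge0.
rewrite TE; case: (ltnP #|codual Fam B| c) => hD.
  have : #|codual Fam B|%:R + 1 <= c%:R :> rat by rewrite natr1 ler_nat.
  have : 0 <= \sum_(v in B) outer_weight Fam B v by apply: sumr_ge0.
  by case: ifP => _; lra.
set j := (#|codual Fam B| - c)%N.
have cj : #|codual Fam B| = (c + j)%N by rewrite /j; lia.
(* At least j + 1 - deg_D(v) members through [v] leave B; in particular deg_D(v) < j - 2 forces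
   four. *)
have Hdv v : v \in B -> (degree (inside Fam B) v + j.+1 <=
   degree Fam v + degree (codual Fam B) v)%N.
  move=> vB; have := degree_inside_codual _ _ vB cB; have := Hdeg v; have := pow_gt.
  have : (2 ^ (k - 2) <= 2 ^ k)%N by rewrite leq_exp2l //; lia.
  by lia.
have ck : (c <= k.+1)%N by case/andP: hc.
have jc : (j + 2 <= c)%N by lia.
have := codual_excess _ _ B (outer_weight Fam B) k.+1 _ _ hk ck cB
  (hereditary_codual _ _ B HF) cj jc Hout.
rewrite cj natrD.
have -> : (if (c < k.+1)%N then c%:R else c%:R + 1 / 2 : rat)
  = c%:R + 1 - (if (c < k.+1)%N then 1 else 2^-1).
  by case: ifP => _; field.
set I := if _ then _ else _; move=> h.
suff : j%:R + I <= \sum_(v in B) outer_weight Fam B v by lra.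
apply: h => v vB hv.
  by apply: outer_weight_ge_half => //; have := Hdv _ vB; lia.
by apply: outer_weight_ge_big => //; have := Hdv _ vB; lia.
Qed.

(** * Sharing excess weight among blocks *)

Definition blocks : {set {set 'I_n}} := [set nbhd Fam x | x in [pred x | centre x]].

Definition blocks_at (v : 'I_n) : {set {set 'I_n}} := [set B in blocks | v \in B].

(** Members that identify [B]: holding a centre of [B], they lie in [B] and in no other block, so
    these families are disjoint for distinct blocks. *)
Definition centred (B : {set 'I_n}) (v : 'I_n) : {set {set 'I_n}} :=
  [set F in Fam | (v \in F) && [exists x in F, centre x && (nbhd Fam x == B)]].

Lemma blocksP B : B \in blocks -> exists2 x, centre x & B = nbhd Fam x.
Proof. by case/imsetP=> x; rewrite inE => Cx ->; exists x. Qed.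

Lemma card_block B : B \in blocks -> #|B| = k.+1.
Proof. by case/blocksP=> x /eqP Cx ->. Qed.

Lemma card_centred B v : B \in blocks -> v \in B -> (2 ^ k.-1 - k <= #|centred B v|)%N.
Proof.
case/blocksP=> x Cx -> vx; apply: leq_trans (codegree_centre _ _ Cx vx) _.
apply: subset_leq_card; apply/subsetP => F; rewrite !inE => /and3P[-> -> xF] /=.
by apply/exists_inP; exists x => //; rewrite Cx eqxx.
Qed.

Lemma centred_sub B v F : F \in centred B v -> F \subset B.
Proof.
rewrite inE => /and3P[FF _ /exists_inP[x xF /andP[_ /eqP <-]]].
exact: sub_nbhd.
Qed.

Lemma centred_uniq B B' v F : F \in centred B v -> B' \in blocks -> F \subset B' -> B = B'.
Proof.
rewrite inE => /and3P[_ _ /exists_inP[x xF /andP[Cx /eqP <-]]] /blocksP[y Cy ->] /subsetP FB.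
by apply: nbhd_eq => //; apply: FB.
Qed.

(** For each other block B at [v], the members in [centred B v] leave [B1], number at least 2^(k-1)
    - k and have size at most k + 1. No member is counted for two blocks. *)
Lemma outer_weight_blocks B1 v : B1 \in blocks -> v \in B1 ->
  \sum_(B in blocks_at v :\ B1) (2 ^ k.-1 - k)%:R / k.+1%:R <= outer_weight Fam B1 v.
Proof.
move=> B1b vB1.
pose g (B F : {set 'I_n}) : rat := if F \in centred B v then (#|F|%:R)^-1 else 0.
apply: (@le_trans _ _ (\sum_(F in Fam | (v \in F) && ~~ (F \subset B1))
   \sum_(B in blocks_at v :\ B1) g B F)); last first.
  apply: ler_sum => F _.
  case: (boolP [exists B in blocks_at v :\ B1, F \in centred B v]) => [/exists_inP[B Bb FB]|].
    rewrite (bigD1 B) //= big1 ?addr0; first by rewrite /g FB.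
    move=> B'; rewrite inE => /andP[/andP[_ Bb'] BB']; rewrite /g; case: ifP => // FB'.
    move: BB'; rewrite (@centred_uniq _ B _ _ FB') ?eqxx ?(centred_sub _ _ _ FB) //.
    by move: Bb; rewrite !inE => /and3P[].
  rewrite negb_exists_in => /forall_inP H.
  by rewrite big1 ?invr_ge0 // => B /H; rewrite /g => /negPf ->.
rewrite exchange_big /=; apply: ler_sum => B Bb.
have [BB1 Bbl vB] : [/\ B != B1, B \in blocks & v \in B].
  by move: Bb; rewrite in_setD1 inE => /and3P[].
have -> : \sum_(F in Fam | (v \in F) && ~~ (F \subset B1)) g B F =
  \sum_(F in centred B v) (#|F|%:R)^-1.
  rewrite [RHS]big_mkcond /= big_mkcond /=; apply: eq_bigr => F _; rewrite /g.
  case: ifP => // /negP H; case: ifP => // FB; case: H.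
  move: (FB); rewrite inE => /and3P[-> -> _] /=.
  by apply: contra BB1 => FB1; apply/eqP; apply: centred_uniq FB B1b FB1.
apply: (@le_trans _ _ (#|centred B v|%:R / k.+1%:R)).
  by rewrite ler_pM2r ?invr_gt0 ?ltr0n // ler_nat card_centred.
rewrite mulr_natl -sumr_const; apply: ler_sum => F FB.
have vF : (0 < #|F|)%N by apply/card_gt0P; exists v; move: FB; rewrite inE => /and3P[].
rewrite lef_pV2 ?posrE ?ltr0n // ler_nat -(card_block _ Bbl).
exact: subset_leq_card (centred_sub _ _ _ FB).
Qed.

Lemma weight_inside_lower B v : B \in blocks -> v \in B ->
  T - (2 * k)%:R <= weight (inside Fam B) v.
Proof.
move=> Bb vB; apply: le_trans (weight_ge _ _ v (hereditary_inside _ _ B HF)).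
have h : (2 * k <= 2 ^ k)%N.
  have := pow_gt; have : (2 ^ (k - 2) <= 2 ^ k)%N by rewrite leq_exp2l //; lia.
  by lia.
have h' : (2 ^ k - 2 * k <= degree (inside Fam B) v)%N.
  have := degree_inside_codual _ _ vB (card_block _ Bb).
  have [x Cx E] := blocksP _ Bb.
  by have := card_codual_centre _ Cx; rewrite -E; lia.
apply: le_trans (popsum_mono _ _ _ (inv_from_ge0 1) h').
apply: le_trans (popsum_inv1_lower _ _ h); rewrite lerD2r.
apply: le_trans (frakB_le _ _ hc) _; rewrite ler_pM2r ?invr_gt0 ?natr1 ?ltr0n //.
by rewrite gerBl.
Qed.

Lemma weight_multi v : (1 < #|blocks_at v|)%N ->
  #|blocks_at v|%:R * (k.+1%:R * k.+1%:R) <= weight Fam v - T.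
Proof.
move=> h1; have : (0 < #|blocks_at v|)%N by lia.
rewrite card_gt0 => /set0Pn[B1 B1v]; have := B1v; rewrite inE => /andP[B1b vB1].
have := outer_weight_blocks _ _ B1b vB1; have := weight_inside_lower _ _ B1b vB1.
rewrite sumr_const -[_ *+ #|_|]mulr_natl (weight_split _ Fam B1 v).
have cR : #|blocks_at v|%:R = 1 + #|blocks_at v :\ B1|%:R :> rat.
  by rewrite (cardsD1 B1) B1v natrD.
rewrite cR.
have r1 : 1 <= #|blocks_at v :\ B1|%:R :> rat.
  by rewrite (ler_nat _ 1); move: h1; rewrite (cardsD1 B1) B1v.
have kk : (48 <= k.-1)%N by lia.
have := quartic_lt_pow _ kk.
have -> : (k.-1 + 2 = k.+1)%N by lia.
move=> hP.
have hP2 : 2 * k.+1%:R * (k.+1%:R * k.+1%:R + k%:R) <= (2 ^ k.-1 - k)%:R :> rat.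
  by rewrite -natrM -natrM -natrD -natrM ler_nat; lia.
have k0 : (0 : rat) < k.+1%:R by rewrite ltr0n.
have : 2 * (k.+1%:R * k.+1%:R + k%:R) <= (2 ^ k.-1 - k)%:R / k.+1%:R :> rat.
  by rewrite ler_pdivlMr // mulrAC.
rewrite natrM.
have kp : (0 : rat) <= k%:R by [].
move: (weight _ _) (outer_weight _ _ _) (#|_|%:R) r1 (k.+1%:R : rat) k0 {hP2 cR} => w o r r1 K K0.
set Q := (_ / _); move=> hQ h2 h3.
(* With [r] further blocks, 2r(K^2 + k) - 2k exceeds the claimed (r + 1)K^2 by exactly (r - 1)(K^2 +
   2k). *)
have h4 : r * (2 * (K * K + k%:R)) <= r * Q by apply: ler_wpM2l => //; lra.
have h5 : 0 <= (r - 1) * (K * K + 2 * k%:R).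
  by apply: mulr_ge0; [lra | apply: addr_ge0; [apply: mulr_ge0; lra | lra]].
lra.
Qed.

Lemma sum_weight_ge : T * n%:R <= \sum_(x < n) weight Fam x.
Proof.
pose e v := weight Fam v - T.
suff : 0 <= \sum_(v < n) e v.
  rewrite /e big_split /= sumrN sumr_const card_ord -[_ *+ n]mulr_natr subr_ge0.
  by [].
pose r v : rat := #|blocks_at v|%:R.
(* The shares of [v] add up to [e v] if it lies in a block. Otherwise they form an empty sum, and
   [e v] is nonnegative because [v] is not a centre and so has a large neighbourhood. *)
apply: (@le_trans _ _ (\sum_(v < n) \sum_(B in blocks | v \in B) e v / r v)); last first.
  apply: ler_sum => v _.
  rewrite (eq_bigl (mem (blocks_at v))); last by move=> B; rewrite !inE.
  rewrite sumr_const -[_ *+ #|_|]mulr_natl -/(r v).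
  case: (posnP #|blocks_at v|) => h0; last by rewrite mulrC divfK // pnatr_eq0 -lt0n.
  rewrite /r h0 mul0r subr_ge0; apply: weight_large_nbhd.
  apply/negP => Cv; move/cards0_eq/setP/(_ (nbhd Fam v)): h0; rewrite !inE.
  move=> /negbT/negP; apply; apply/andP; split.
    by apply/imsetP; exists v.
  by move: (in_nbhd v); rewrite inE.
rewrite (exchange_big_dep (mem blocks)) /=; last by move=> v B _ /andP[].
apply: sumr_ge0 => B Bb.
rewrite (eq_bigl (mem B)); last by move=> v; rewrite Bb.
have r1 v : v \in B -> 1 <= r v.
  move=> vB; rewrite (ler_nat _ 1) card_gt0; apply/set0Pn; exists B.
  by rewrite inE Bb.
have k0 : (0 : rat) <= k%:R by [].
(* One vertex in several blocks brings a share of at least (k+1)^2, which pays for a loss of at most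
   [k] at each other vertex of [B]. *)
case: (boolP [exists v in B, 1 < #|blocks_at v|]%N) => [/exists_inP[v0 v0B hv0]|].
  rewrite (bigD1 v0) //=.
  have h1 : k.+1%:R * k.+1%:R <= e v0 / r v0.
    rewrite ler_pdivlMr; first by rewrite mulrC; apply: weight_multi.
    by apply: lt_le_trans (r1 _ v0B).
  have h2 : \sum_(v in B | v != v0) - k%:R <= \sum_(v in B | v != v0) e v / r v.
    apply: ler_sum => v /andP[vB _].
    have hr := r1 _ vB; have r0 : 0 < r v by apply: lt_le_trans hr.
    rewrite ler_pdivlMr //; apply: (@le_trans _ _ (- k%:R)).
      by rewrite mulNr lerN2 ler_peMr.
    by have := weight_lower v; rewrite /e; lra.
  have h3 : - (k.+1%:R * k%:R) <= \sum_(v in B | v != v0) - k%:R :> rat.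
    rewrite sumrN lerN2 sumr_const -[leLHS]mulr_natl; apply: ler_wpM2r => //.
    rewrite ler_nat -(card_block _ Bb); apply: subset_leq_card.
    by apply/subsetP => v /andP[].
  have h4 : k.+1%:R * k%:R <= k.+1%:R * k.+1%:R :> rat by rewrite ler_wpM2l // ler_nat.
  lra.
(* Every vertex lies in [B] alone, so each divisor is 1 and [block_weight] applies. *)
rewrite negb_exists_in => /forall_inP H.
have [x Cx E] := blocksP _ Bb; have := block_weight _ Cx; rewrite -E => hB.
rewrite (eq_bigr e) => [|v vB]; last first.
  have := H v vB; have := r1 v vB; rewrite /r (ler_nat _ 1) -leqNgt => g1 g2.
  by rewrite (_ : #|_| = 1%N) ?divr1 //; apply/eqP; rewrite eqn_leq g1 g2.
rewrite /e big_split /= sumrN sumr_const (card_block _ Bb) -[_ *+ k.+1]mulr_natl.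
by rewrite subr_ge0.
Qed.
End DegreeCondition.

Theorem mainTheorem11 (n d c : nat) (Fam : {set {set 'I_n}}) :
  (50 <= d)%N -> (1 <= c)%N -> (c <= d)%N ->
  hereditary Fam ->
  (forall x : 'I_n, (2 ^ d.-1 - c + 1 <= degree Fam x)%N) ->
  frakB d c * n%:R <= \sum_(x < n) weight Fam x.
Proof.
case: d => [|k] hk c1 cd HF Hdeg; first discriminate hk.
have hc : (1 <= c <= k.+1)%N by rewrite c1 cd.
exact: (@sum_weight_ge n k c Fam hk hc HF Hdeg).
Qed.
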